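(* Let $K$ be a field of characteristic zero with a non-trivial non-Archimedean absolute value and valuation $v:K^\times\to\mathbb{R}$, let $V$ be an $n$-dimensional $K$-vector space ($n\ge2$), and let $\lambda=(\lambda_1\ge\dots\ge\lambda_n\ge0)$ be a partition. Let $\rho$ be the geometrically irreducible algebraic representation $\mathfrak{S}_\lambda(V)$ of $SL(V)$ with character the Schur polynomial $S_\lambda$. Assume that all (nonzero) coefficients of $S_\lambda$, regarded as elements of $K$, have valuation zero. Then the fan $\mathcal{F}_\rho$ coincides with the image of the polyhedral complex $\mathcal{C}(S_\lambda)$ under the quotient map $\mathbb{R}^n\to\mathbb{T}^{n-1}=\mathbb{R}^n/\mathbb{R}(1,\dots,1)\simeq A$.
   Context: The Schur polynomial is $S_\lambda(z_1,\dots,z_n)=\det\big(z_j^{\lambda_i+n-i}\big)_{i,j}/\det\big(z_j^{n-i}\big)_{i,j}$; write $S_\lambda=\sum_N c_Nz^N$ with $N=(\nu_1,\dots,\nu_n)$, $z^N=z_1^{\nu_1}\cdots z_n^{\nu_n}$ (coefficients are integers, the Kostka numbers). $\mathfrak{S}_\lambda(V)$ is the irreducible representation of $SL(V)$ such that for every $g\in SL(V)$ with eigenvalues $c_1,\dots,c_n$ the trace of $g$ on it is $S_\lambda(c_1,\dots,c_n)$. Fix a basis $e_1,\dots,e_n$ of $V$, let $T$ be the diagonal maximal split torus, $a_i$ the character $\mathrm{diag}(s_1,\dots,s_n)\mapsto s_i$ (so $X^*(T)=\bigoplus\mathbb{Z}a_i/\mathbb{Z}(a_1+\dots+a_n)$),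 $\eta_i$ the cocharacter of $GL(V)$ with $s$ in position $i$ and $1$ elsewhere, $a_i(\eta_j)=\delta_{ij}$. The apartment is $A=\{\sum_ix_i\eta_i:x_i\in\mathbb{R},\sum_ix_i=0\}$, identified with $\mathbb{T}^{n-1}=\mathbb{R}^n/\mathbb{R}(1,\dots,1)$ by sending $\eta_i$ to the $i$-th standard basis vector. A weight of $\rho$ is a character $\mu$ of $T$ with nonzero weight space; the weights are exactly $\nu_1a_1+\dots+\nu_na_n$ for $N$ with $c_N\neq0$, and a character $\mu=\sum\mu_ia_i$ is evaluated on $x=\sum x_i\eta_i\in A$ by $\mu(x)=\sum\mu_ix_i$. The root system is $\Phi=\{a_i/a_j: i\ne j\}$ (written additively $a_i-a_j$); a basis $\Delta$ of $\Phi$ is a linearly independent subset such that each root is an integer combination of $\Delta$ with all coefficients $\ge0$ or all $\le0$. For each basis $\Delta$, the highest weight $\mu_0(\Delta)$ is the weight such that $\mu_0(\Delta)-\mu$ is a non-negative integer combination of $\Delta$ for every weight $\mu$. The fan $\mathcal{F}_\rho$ is the set of all faces of the cones $C_\Delta(\rho)=\{x\in A:\mu_0(\Delta)(x)\ge\mu(x)\text{ for all weights }\mu\}$, $\Delta$ ranging over bases of $\Phi$. Let $P\subset\mathbb{R}^{n+1}$ be the convex hull of the points $(-v(c_N),\nu_1,\dots,\nu_n)$ with $c_N\neq0$; its normal fan consists of the cones $\mathcal{N}_P(F)=\{w\in\mathbb{R}^{n+1}: F\subseteq\{y\in P:\langle w,y\rangle=\max_{z\in P}\langle w,z\rangle\}\}$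 for nonempty faces $F$ of $P$. The polyhedral complex $\mathcal{C}(S_\lambda)$ in $\mathbb{R}^n$ consists of all cells $\mathcal{N}_P(F)\cap\{w_0=-1\}$ (identifying $\{w_0=-1\}$ with $\mathbb{R}^n$ via the last $n$ coordinates). *)

(* Defs.v *)
From HB Require Import structures.
From mathcomp Require Import all_boot all_order all_algebra.
From mathcomp Require Import boolp classical_sets reals.
From mathcomp Require Import mpoly.

Set Implicit Arguments.
Unset Strict Implicit.
Unset Printing Implicit Defensive.

Import Order.TTheory GRing.Theory Num.Theory.

Local Open Scope classical_set_scope.
Local Open Scope ring_scope.

(** * Valuations *)

(* [v] is the additive form - log |.| of a non-trivial non-Archimedean absolute
   value.  Only the values of [v] on nonzero elements are meaningful; [v 0] is
   unconstrained and never used. *)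
Record nontrivial_valuation (K : fieldType) (R : realType) (v : K -> R) :
    Prop := NontrivialValuation {
  valuationM : forall x y : K, x != 0 -> y != 0 -> v (x * y) = v x + v y;
  valuationD : forall x y : K, x != 0 -> y != 0 -> x + y != 0 ->
    Num.min (v x) (v y) <= v (x + y);
  valuation_nontrivial : exists2 x : K, x != 0 & v x != 0
}.

(** * Schur polynomials *)

Definition is_partition (n : nat) (lam : 'I_n -> nat) : Prop :=
  forall i j : 'I_n, (i <= j)%N -> (lam j <= lam i)%N.

(* Indices start at 0, so the exponent lambda_i + n - i becomes
   [lam i + (n.-1 - i)]. *)
Definition alternant (n : nat) (lam : 'I_n -> nat) : {mpoly int[n]} :=
  \det (\matrix_(i < n, j < n) ('X_j : {mpoly int[n]}) ^+ (lam i + (n.-1 - i))).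

(* The quotient of the two determinants is taken in the fraction field. *)
Definition is_schur (n : nat) (lam : 'I_n -> nat) (S : {mpoly int[n]}) : Prop :=
  tofrac S = tofrac (alternant lam) / tofrac (alternant (fun=> 0%N)).

(** * Representations of SL(V) *)

(* The matrix of an endomorphism in a basis, acting on row vectors: row i holds
   the coordinates of the image of e_i.  This is [passmx.mxof e e], except that
   the latter requires the length of [e] to be syntactically [\dim {:V}]. *)
Definition lfun_mx (K : fieldType) (n : nat) (V : vectType K) (e : n.-tuple V)
    (g : 'End(V)) : 'M[K]_n :=
  \matrix_(i < n, j < n) coord e j (g (tnth e i)).

Section Representation.

Variables (K : fieldType) (n : nat) (V : vectType K) (e : n.-tuple V).
Variables (d : nat) (W : vectType K) (f : d.-tuple W).
Variable rho : 'End(V) -> 'End(W).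

(* [e] and [f] are meant to be bases of V and W. *)

Definition in_SL (g : 'End(V)) : Prop := \det (lfun_mx e g) = 1.

Definition is_representation : Prop :=
  rho \1%VF = \1%VF /\
  (forall g h : 'End(V), in_SL g -> in_SL h ->
     rho (g \o h)%VF = (rho g \o rho h)%VF).

(* A matrix [M] of polynomials in the n * n matrix entries, evaluated at a
   matrix [A] over an extension [iota : K -> L]. *)
Definition eval_polymx (L : fieldType) (iota : {rmorphism K -> L})
    (M : 'M[{mpoly K[n * n]}]_d) (A : 'M[L]_n) : 'M[L]_d :=
  \matrix_(i < d, j < d) mmap iota (fun k => mxvec A 0 k) (M i j).

Definition represented_by (M : 'M[{mpoly K[n * n]}]_d) : Prop :=
  forall g : 'End(V), in_SL g ->
    lfun_mx f (rho g) = eval_polymx idfun M (lfun_mx e g).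

Definition irreducible_over (L : fieldType) (iota : {rmorphism K -> L})
    (M : 'M[{mpoly K[n * n]}]_d) : Prop :=
  (0 < d)%N /\
  forall U : 'M[L]_d,
    (forall A : 'M[L]_n, \det A = 1 -> stablemx U (eval_polymx iota M A)) ->
    U = 0 \/ row_full U.

(* Since SL(V)(K) is Zariski dense in SL(V) when K is infinite, the polynomial
   matrix [M] is determined by [rho] as a matrix of functions on SL(V); the base
   change of [rho] to L is the representation of SL_n(L) given by [M]. *)
Definition geom_irreducible_algebraic : Prop :=
  is_representation /\
  exists2 M : 'M[{mpoly K[n * n]}]_d, represented_by M &
    forall (L : fieldType) (iota : {rmorphism K -> L}), irreducible_over iota M.

(* The eigenvalues of [g], listed with multiplicity, may live in an extension of
   K. *)
Definition has_schur_character (S : {mpoly int[n]}) : Prop :=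
  forall (L : fieldType) (iota : {rmorphism K -> L}) (g : 'End(V))
      (c : 'I_n -> L),
    in_SL g ->
    map_poly iota (char_poly (lfun_mx e g)) = \prod_(i < n) ('X - (c i)%:P) ->
    iota (\tr (lfun_mx f (rho g))) = mmap (intr : int -> L) c S.

(** Characters of T and weights *)

(* [mu] stands for the character \sum_i mu_i a_i; two such vectors give the same
   element of X^*(T) = Z^n / Z(1, ..., 1) when they are related by [char_eq]. *)
Definition char_eq (mu nu : 'rV[int]_n) : Prop :=
  exists k : int, mu - nu = const_mx k.

Definition weight_space (mu : 'rV[int]_n) : set W :=
  [set w | forall (g : 'End(V)) (s : 'I_n -> K),
     (forall i, g (tnth e i) = s i *: tnth e i) -> \prod_(i < n) s i = 1 ->
     rho g w = (\prod_(i < n) s i ^ mu 0 i) *: w].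

Definition is_weight (mu : 'rV[int]_n) : Prop :=
  exists2 w : W, w != 0 & weight_space mu w.

(** Root system *)

(* The root a_i - a_j is indexed by the pair (i, j), i != j; distinct pairs give
   distinct elements of X^*(T). *)
Definition root_vec (p : 'I_n * 'I_n) : 'rV[int]_n :=
  delta_mx 0 p.1 - delta_mx 0 p.2.

Definition root_system : {set 'I_n * 'I_n} := [set p | p.1 != p.2]%SET.

Definition nonneg_comb (D : {set 'I_n * 'I_n}) (mu : 'rV[int]_n) : Prop :=
  exists c : 'I_n * 'I_n -> nat, char_eq mu (\sum_(p in D) root_vec p *+ c p).

(* X^*(T) is torsion free, so independence can be tested over Z. *)
Definition is_root_basis (D : {set 'I_n * 'I_n}) : Prop :=
  [/\ D \subset root_system,
      forall c : 'I_n * 'I_n -> int,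
        char_eq (\sum_(p in D) root_vec p *~ c p) 0 ->
        forall p, p \in D -> c p = 0 &
      forall p, p \in root_system ->
        nonneg_comb D (root_vec p) \/ nonneg_comb D (- root_vec p)].

Definition is_highest_weight (D : {set 'I_n * 'I_n}) (mu0 : 'rV[int]_n) : Prop :=
  is_weight mu0 /\ forall mu, is_weight mu -> nonneg_comb D (mu0 - mu).

End Representation.

(** * Polyhedra *)

Section Polyhedra.

Variable R : realType.

Definition dotv (m : nat) (w y : 'rV[R]_m) : R := \sum_(i < m) w 0 i * y 0 i.

Definition maximizers (m : nat) (w : 'rV[R]_m) (P : set 'rV[R]_m) :
    set 'rV[R]_m :=
  [set y | P y /\ forall z, P z -> dotv w z <= dotv w y].

(* Faces are nonempty; [w = 0] shows that P is a face of itself. *)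
Definition is_face (m : nat) (F P : set 'rV[R]_m) : Prop :=
  F !=set0 /\ exists w : 'rV[R]_m, F = maximizers w P.

Definition normal_cone (m : nat) (P F : set 'rV[R]_m) : set 'rV[R]_m :=
  [set w | F `<=` maximizers w P].

End Polyhedra.

(** * The apartment and the fan of a representation *)

Section Fan.

Variables (K : fieldType) (n : nat) (V : vectType K) (e : n.-tuple V).
Variables (W : vectType K) (rho : 'End(V) -> 'End(W)) (R : realType).

Definition apartment : set 'rV[R]_n := [set x | \sum_(i < n) x 0 i = 0].

Definition char_eval (mu : 'rV[int]_n) (x : 'rV[R]_n) : R :=
  \sum_(i < n) (mu 0 i)%:~R * x 0 i.

Definition weight_cone (mu0 : 'rV[int]_n) : set 'rV[R]_n :=
  [set x | apartment x /\
     forall mu, is_weight e rho mu -> char_eval mu x <= char_eval mu0 x].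

Definition fan : set (set 'rV[R]_n) :=
  [set F | exists (D : {set 'I_n * 'I_n}) (mu0 : 'rV[int]_n),
     [/\ is_root_basis D, is_highest_weight e rho D mu0 &
         is_face F (weight_cone mu0)]].

(* The quotient map R^n -> R^n / R(1, ..., 1) followed by the identification of
   the quotient with the apartment: the class of y is sent to its unique
   representative with coordinate sum 0. *)
Definition to_apartment (y : 'rV[R]_n) : 'rV[R]_n :=
  y - const_mx ((\sum_(i < n) y 0 i) / n%:R).

End Fan.

Arguments fan {K n V} e {W} rho R _.
Arguments to_apartment {n R} y.

(** * The polyhedral complex of a polynomial *)

Section Complex.

Variables (K : fieldType) (R : realType) (v : K -> R).
Variables (n : nat) (S : {mpoly int[n]}).

Definition newton_point (N : 'X_{1..n}) : 'rV[R]_(1 + n) :=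
  row_mx (const_mx (- v (S@_N)%:~R)) (\row_(i < n) (N i)%:R).

Definition newton_polytope : set 'rV[R]_(1 + n) :=
  [set y | exists t : 'X_{1..n} -> R,
     [/\ forall N, N \in msupp S -> 0 <= t N,
         \sum_(N <- msupp S) t N = 1 &
         y = \sum_(N <- msupp S) t N *: newton_point N]].

(* The slice {w_0 = -1} is identified with R^n via the last n coordinates. *)
Definition complex_cell (F : set 'rV[R]_(1 + n)) : set 'rV[R]_n :=
  [set x | normal_cone newton_polytope F (row_mx (const_mx (- 1)) x)].

Definition poly_complex : set (set 'rV[R]_n) :=
  [set C | exists2 F, is_face F newton_polytope & C = complex_cell F].

End Complex.

(* Main.v *)
(* Restricted to T, the matrix of rho is a sum of characters with matrix
   coefficients; by independence of characters the coefficients are idempotents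
   onto the weight spaces, with traces the coefficients of S.  In characteristic
   zero an idempotent vanishes iff its trace does, so the weights are exactly the
   monomials of S.

   Since v vanishes on the coefficients, the complex is the normal fan of the
   Newton polytope of S: its cells are the sets of x that are maximized by every
   monomial maximized by some fixed w.  Writing C_u for the cone of all x maximized
   by the monomial u, a face of C_u is the cell of a point w in its relative
   interior.  Conversely, if w is sorted decreasingly by the permutation s, then
   u = lam o s^-1 is maximal for w and is the highest weight for the simple roots
   a_s(i) - a_s(i+1), because every monomial of S is dominated by lam; the cell of
   w is the face of C_u cut out by the sum of m - u over the monomials m maximal
   for w.  Dominance follows by comparing weighted degrees in
   S * alternant 0 = alternant lam. *)

Require Import Defs.
From HB Require Import structures.
From mathcomp Require Import all_boot all_order all_algebra.
From mathcomp Require Import boolp classical_sets reals.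
From mathcomp Require Import fingroup perm mpoly zify lra.

Set Implicit Arguments.
Unset Strict Implicit.
Unset Printing Implicit Defensive.

Import Order.TTheory GRing.Theory Num.Theory.

Local Open Scope classical_set_scope.
Local Open Scope ring_scope.

(** * The support of a Schur polynomial *)

Definition weighted_deg (n : nat) (w : 'I_n -> nat) (m : 'X_{1..n}) : nat :=
  (\sum_(i < n) w i * m i)%N.

(* Substituting X_i T^(w_i) for X_i turns the weighted degree into the degree
   in T, which is additive on products because the coefficient ring is a
   domain. *)
Definition weight_grading (n : nat) (w : 'I_n -> nat) (p : {mpoly int[n]}) :
    {poly {mpoly int[n]}} :=
  mmap (@polyC {mpoly int[n]} \o @mpolyC n int)
       (fun i => ('X_i : {mpoly int[n]}) *: 'X^(w i)) p.

Lemma weight_gradingM (n : nat) (w : 'I_n -> nat) (p q : {mpoly int[n]}) :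
  weight_grading w (p * q) = weight_grading w p * weight_grading w q.
Proof. by rewrite /weight_grading rmorphM. Qed.

Lemma weight_gradingE (n : nat) (w : 'I_n -> nat) (p : {mpoly int[n]}) :
  weight_grading w p =
  \sum_(m <- msupp p) (p@_m *: 'X_[m]) *: 'X^(weighted_deg w m).
Proof.
rewrite /weight_grading /mmap; apply: eq_bigr => m _ /=.
rewrite mul_polyC -mul_mpolyC -scalerA; congr (_ *: _).
rewrite /mmap1 mpolyXE_id /weighted_deg.
elim/big_rec3: _ => [|i a b c _ ->]; first by rewrite expr0 scale1r.
by rewrite exprZn -exprM -scalerAl -scalerAr scalerA exprD.
Qed.

Lemma coef_weight_grading (n : nat) (w : 'I_n -> nat) (p : {mpoly int[n]}) k :
  (weight_grading w p)`_k =
  \sum_(m <- msupp p | weighted_deg w m == k) p@_m *: 'X_[m].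
Proof.
rewrite weight_gradingE coef_sum [RHS]big_mkcond /=; apply: eq_bigr => m _.
by rewrite coefZ coefXn eq_sym; case: eqP; rewrite ?mulr1 ?mulr0.
Qed.

(** The variables survive in the coefficients, so distinct monomials of equal weight cannot cancel
    and the coefficient of ['X^(weighted_deg w m)] is nonzero. *)
Lemma weighted_deg_lt_size (n : nat) (w : 'I_n -> nat) (p : {mpoly int[n]}) m :
  m \in msupp p -> (weighted_deg w m < size (weight_grading w p))%N.
Proof.
move=> mp; rewrite ltnNge; apply/negP => /leq_sizeP/(_ _ (leqnn _)) c0.
move: mp; rewrite mcoeff_msupp => /eqP; apply.
have := congr1 (mcoeff m) c0.
rewrite coef_weight_grading raddf_sum mcoeff0 big_mkcond /=.
have [mp|/memN_msupp_eq0 //] := boolP (m \in msupp p).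
rewrite (bigD1_seq m) ?msupp_uniq //= eqxx mcoeffZ mcoeffX eqxx mulr1.
rewrite big1 ?addr0 // => m' /negbTE nm; case: eqP => // _.
by rewrite mcoeffZ mcoeffX nm mulr0.
Qed.

Lemma size_weight_grading_le (n : nat) (w : 'I_n -> nat) (p : {mpoly int[n]}) a :
  (forall m, m \in msupp p -> (weighted_deg w m <= a)%N) ->
  (size (weight_grading w p) <= a.+1)%N.
Proof.
move=> H; apply/leq_sizeP => k ak.
rewrite coef_weight_grading big_seq_cond big1 // => m /andP[/H ma /eqP wk].
by move: ak; rewrite -wk ltnNge ma.
Qed.

(** Degrees in T add up in a product over a domain, so an upper bound on [p * q] and a lower bound
    on [q] leave an upper bound on [p]. *)
Lemma weighted_deg_factor (n : nat) (w : 'I_n -> nat) (p q : {mpoly int[n]})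
    (a b : nat) (m0 : 'X_{1..n}) :
  (forall m, m \in msupp (p * q) -> (weighted_deg w m <= a + b)%N) ->
  m0 \in msupp q -> (b <= weighted_deg w m0)%N ->
  forall m, m \in msupp p -> (weighted_deg w m <= a)%N.
Proof.
(* Here [s] and [t] stand for the sizes of the two gradings. A size exceeds the degree by one,
   whence [.-1] for the product and [.+1] in the bound. *)
have arith x y s t :
  (x < s -> y < t -> (s + t).-1 <= (a + b).+1 -> b <= y -> x <= a)%N by lia.
move=> /size_weight_grading_le sz m0q bm0 m mp.
have sp := weighted_deg_lt_size w mp.
have sq := weighted_deg_lt_size w m0q.
have p0 : weight_grading w p != 0 by rewrite -size_poly_gt0; case: size sp.
have q0 : weight_grading w q != 0 by rewrite -size_poly_gt0; case: size sq.
move: sz; rewrite weight_gradingM (size_mul p0 q0) => sz.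
exact: arith sp sq sz bm0.
Qed.

(** As [q] is homogeneous of degree [b], the component of [p * q] in degree [d + b] is the degree
    [d] component of [p] times [q]. If [d + b] differs from [a] it vanishes, and so does that
    component of [p]. *)
Lemma homog_factor (n : nat) (p q : {mpoly int[n]}) (a b : nat) :
  q != 0 -> q \is ishomog1 b mdeg -> p * q \is ishomog1 a mdeg ->
  forall m, m \in msupp p -> (mdeg m + b = a)%N.
Proof.
move=> q0 qb pqa m mp; apply/eqP/negP => /negP ne.
set d := mdeg m in ne.
have E : pihomog mdeg (d + b) (p * q) = pihomog mdeg d p * q.
  rewrite {1}(@pihomog_partitionE _ _ mdeg _ p (leqnn _)) mulr_suml raddf_sum /=.
  rewrite (bigD1 (Ordinal (msize_mdeg_lt mp))) //= big1 ?addr0.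
    by apply: pihomog_dE; apply: dhomogM => //; apply: pihomogP.
  move=> i ni; apply: (@pihomog_ne0 _ _ _ (i + b)%N).
    by rewrite eqn_add2r; apply: contra ni => /eqP e; apply/eqP/val_inj.
  by apply: dhomogM => //; apply: pihomogP.
move: E; rewrite (pihomog_ne0 _ pqa) 1?eq_sym // => /esym/eqP.
rewrite mulf_eq0 (negbTE q0) orbF => /eqP/(congr1 (mcoeff m)).
rewrite mcoeff0 pihomogE raddf_sum /= big_mkcond /=.
rewrite (bigD1_seq m) ?msupp_uniq //= eqxx big1 => [|m' /negbTE nm].
  by rewrite addr0 mcoeffZ mcoeffX eqxx mulr1 => /eqP; rewrite mcoeff_eq0 mp.
by case: eqP => // _; rewrite mcoeffZ mcoeffX nm mulr0.
Qed.

(** * Alternants and their monomials *)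

Definition shifted_exp (n : nat) (lam : 'I_n -> nat) (s : 'S_n) : 'X_{1..n} :=
  [multinom (lam (s i) + (n.-1 - s i))%N | i < n].

Lemma alternantE (n : nat) (lam : 'I_n -> nat) :
  alternant lam = \sum_(s : 'S_n) (-1) ^+ s *: 'X_[shifted_exp lam s].
Proof.
(* After transposition the product of the Leibniz formula runs over the variables, and [s] picks the
   row. *)
rewrite /alternant -det_tr; apply: eq_bigr => s _.
rewrite -mul_mpolyC rmorphXn rmorphN1; congr (_ * _).
rewrite mpolyXE_id; apply: eq_bigr => i _.
by rewrite !mxE /shifted_exp mnmE.
Qed.

(** Adding the staircase makes a partition strictly decreasing, so the exponent at [i] determines
    [s i]. Hence no two terms of the alternant cancel. *)
Lemma shifted_exp_inj (n : nat) (lam : 'I_n -> nat) :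
  is_partition lam -> injective (shifted_exp lam).
Proof.
move=> plam s t /mnmP E; apply/permP => i; apply/val_inj/eqP => /=.
have := E i; rewrite !mnmE.
move: (plam (s i) (t i)) (plam (t i) (s i)) (ltn_ord (s i)) (ltn_ord (t i)).
by lia.
Qed.

Lemma mcoeff_alternant (n : nat) (lam : 'I_n -> nat) (s : 'S_n) :
  is_partition lam -> (alternant lam)@_(shifted_exp lam s) = (-1) ^+ s.
Proof.
move=> plam; rewrite alternantE raddf_sum /= (bigD1 s) //= big1 => [|t nts].
  by rewrite mcoeffZ mcoeffX eqxx mulr1 addr0.
by rewrite mcoeffZ mcoeffX (inj_eq (shifted_exp_inj plam)) (negbTE nts) mulr0.
Qed.

Lemma shifted_exp_msupp (n : nat) (lam : 'I_n -> nat) (s : 'S_n) :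
  is_partition lam -> shifted_exp lam s \in msupp (alternant lam).
Proof. by move=> plam; rewrite mcoeff_msupp mcoeff_alternant // signr_eq0. Qed.

Lemma msupp_alternant (n : nat) (lam : 'I_n -> nat) (m : 'X_{1..n}) :
  m \in msupp (alternant lam) -> exists s, m = shifted_exp lam s.
Proof.
rewrite mcoeff_msupp alternantE raddf_sum /= => nz.
apply: contrapT => no; move/eqP: nz; apply.
rewrite big1 // => s _; rewrite mcoeffZ mcoeffX.
by case: eqP => [E|]; rewrite ?mulr0 //; case: no; exists s.
Qed.

(** * Prefix sums and the dominance order *)

Definition prefix_sum (n : nat) (k : nat) (x : 'I_n -> nat) : nat :=
  (\sum_(i < n | (i < k)%N) x i)%N.

(** The first [k] entries of a decreasing sequence have the largest sum among all choices of [k]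
    positions: compare both choices with a threshold separating the entries before [k] from the
    others. *)
Lemma prefix_sum_perm_le (n : nat) (l : 'I_n -> nat) (t : 'S_n) (k : nat) :
  is_partition l -> (prefix_sum k (fun i => l (t i)) <= prefix_sum k l)%N.
Proof.
move=> pl; rewrite /prefix_sum.
rewrite (reindex_inj (@perm_inj _ t^-1%g)) /=.
under eq_bigr do rewrite permKV.
(* The threshold is the entry at [k], or 0 if there is no such position. *)
have [c lc] : exists c, forall i : 'I_n,
    ((i < k)%N -> (c <= l i)%N) /\ ((k <= i)%N -> (l i <= c)%N).
  have [kn|nk] := ltnP k n.
    exists (l (Ordinal kn)) => i; split=> ik; apply: pl => //=.
    exact: ltnW.
  by exists 0%N => i; split=> // ki; have := ltn_ord i; rewrite ltnNge (leq_trans nk).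
have card : (\sum_(i < n | (t^-1%g i < k)%N) c = \sum_(i < n | (i < k)%N) c)%N.
  by rewrite [RHS](reindex_inj (@perm_inj _ t^-1%g)).
rewrite -(leq_add2r (\sum_(i < n | (i < k)%N) c)%N) -[X in (_ <= _ + X)%N]card.
rewrite !(big_mkcond (fun i => (_ < _)%N)) /=.
rewrite -!big_split /=; apply: leq_sum => i _; have [] := lc i.
by case: (ltnP i k); case: (ltnP (t^-1%g i) k); lia.
Qed.

Lemma prefix_sum_inj (n : nat) (x y : 'I_n -> nat) :
  (forall k, prefix_sum k x = prefix_sum k y) -> x =1 y.
Proof.
have step (z : 'I_n -> nat) (i : 'I_n) :
    prefix_sum i.+1 z = (prefix_sum i z + z i)%N.
  rewrite /prefix_sum (bigD1 i) //= addnC; congr (_ + _)%N.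
  apply: eq_bigl => j; rewrite ltnS leq_eqVlt -(inj_eq val_inj) /=.
  by case: ltngtP.
by move=> E i; have := E i.+1; rewrite !step E => /addnI.
Qed.

Lemma prefix_sumD (n k : nat) (x y : 'I_n -> nat) :
  prefix_sum k (fun i => x i + y i)%N = (prefix_sum k x + prefix_sum k y)%N.
Proof. exact: big_split. Qed.

(** The 0/1 weight that selects the positions [s i] with [i < k] makes a prefix sum a weighted
    degree, so that [weighted_deg_factor] gives dominance. *)
Lemma weighted_deg_prefix (n k : nat) (s : 'S_n) (m : 'X_{1..n}) :
  weighted_deg (fun j => ((s^-1)%g j < k)%N : nat) m =
  prefix_sum k (fun i => m (s i)).
Proof.
rewrite /weighted_deg /prefix_sum (reindex_inj (@perm_inj _ s)) /=.
rewrite [RHS]big_mkcond /=; apply: eq_bigr => i _; rewrite permK.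
by case: ltnP; rewrite ?mul1n ?mul0n.
Qed.

(** * Dominance and extremal monomials of a Schur polynomial *)

Section SchurSupport.

Variables (n : nat) (lam : 'I_n -> nat) (S : {mpoly int[n]}).
Hypotheses (plam : is_partition lam) (hS : is_schur lam S).

Let plam0 : is_partition (fun=> 0%N : nat) := fun (i j : 'I_n) _ => leqnn 0.

Let shifted_partition (mu : 'I_n -> nat) : is_partition mu ->
  is_partition (fun i : 'I_n => mu i + (n.-1 - i))%N.
Proof. by move=> pmu i j ij; apply: leq_add; [exact: pmu | exact: leq_sub2l]. Qed.

Let vandermonde_neq0 : alternant (fun _ : 'I_n => 0%N) != 0.
Proof.
apply/eqP => E; have := shifted_exp_msupp 1%g plam0.
by rewrite E mcoeff_msupp mcoeff0 eqxx.
Qed.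

Lemma schurM : S * alternant (fun=> 0%N) = alternant lam.
Proof.
apply/eqP; rewrite -tofrac_eq tofracM hS divfK //.
by rewrite tofrac_eq0.
Qed.

(** For the 0/1 weight of [s] and [k], [alternant lam] has degree at most the prefix sum of [lam]
    plus that of the staircase, and the Vandermonde factor has a monomial reaching the staircase
    part. *)
Lemma schur_prefix_sum_le (s : 'S_n) (k : nat) (m : 'X_{1..n}) :
  m \in msupp S -> (prefix_sum k (fun i => m (s i)) <= prefix_sum k lam)%N.
Proof.
move=> mS; rewrite -weighted_deg_prefix.
apply: (weighted_deg_factor (q := alternant (fun=> 0%N))
  (b := prefix_sum k (fun i : 'I_n => (n.-1 - i)%N))
  (m0 := shifted_exp (fun=> 0%N) (s^-1)%g)) mS.
- move=> m'; rewrite schurM => /msupp_alternant[t ->].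
  rewrite weighted_deg_prefix -prefix_sumD.
  apply: leq_trans (prefix_sum_perm_le (s * t) k (shifted_partition plam)).
  by apply: eq_leq; apply: eq_bigr => i _; rewrite mnmE permM.
- exact: shifted_exp_msupp.
- rewrite weighted_deg_prefix; apply: eq_leq; apply: eq_bigr => i _.
  by rewrite mnmE permK.
Qed.

Lemma schur_mdeg (m : 'X_{1..n}) :
  m \in msupp S -> mdeg m = (\sum_(i < n) lam i)%N.
Proof.
move=> mS; apply: (@addIn (\sum_(i < n) (n.-1 - i))%N); rewrite -big_split /=.
have hom_alt mu : alternant mu \is ishomog1 (\sum_(i < n) (mu i + (n.-1 - i)))%N mdeg.
  apply/dhomogP => m' /msupp_alternant[t ->].
  rewrite /= mdegE [RHS](reindex_inj (@perm_inj _ t)) /=.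
  by apply: eq_bigr => i _; rewrite mnmE.
apply: homog_factor vandermonde_neq0 (hom_alt _) _ _ mS.
by rewrite schurM; apply: hom_alt.
Qed.

(** The monomial of [s] in [alternant lam] is a product of a monomial [m] of [S] and a permuted
    staircase. After undoing [s], the two factors are dominated by [lam] and by the staircase while
    their product attains both bounds, so [m] is [lam] permuted by [s]. *)
Lemma schur_orbit_msupp (s : 'S_n) : [multinom lam (s i) | i < n] \in msupp S.
Proof.
have := shifted_exp_msupp s plam.
rewrite -schurM => /msuppM_le/allpairsP[[m m'] /= [mS /msupp_alternant[t ->] E]].
suff -> : [multinom lam (s i) | i < n] = m by [].
have mE i : (m i + (n.-1 - t i) = lam (s i) + (n.-1 - s i))%N.
  by move/mnmP: E => /(_ i); rewrite mnmDE !mnmE.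
suff eqm : (fun i => m ((s^-1)%g i)) =1 lam.
  by apply/mnmP => i; rewrite mnmE -eqm permK.
apply: prefix_sum_inj => k; apply/eqP; rewrite eqn_leq schur_prefix_sum_le //=.
have := prefix_sum_perm_le (s^-1 * t) k (shifted_partition plam0).
rewrite -(leq_add2l (prefix_sum k lam)) -prefix_sumD.
rewrite -[X in (_ <= X)%N -> _]prefix_sumD => le.
rewrite -(leq_add2r (prefix_sum k (fun i => 0 + (n.-1 - (s^-1 * t)%g i)))%N).
rewrite -prefix_sumD -[X in (_ <= X)%N]prefix_sumD.
apply: leq_trans le _; apply: eq_leq.
apply: eq_bigr => i _.
by have := mE ((s^-1)%g i); rewrite permKV permM !add0n => ->.
Qed.

End SchurSupport.

(** * Weights of a representation and its character *)

(** Dedekind's independence of characters, by induction on their number. The coefficients lie in a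
    module so that they can be matrices. *)
Lemma character_independence (K : fieldType) (V : lmodType K) (T : Type)
    (I : eqType) (D : T -> Prop) (one : T) (mul : T -> T -> T)
    (chi : I -> T -> K) (r : seq I) :
  D one -> (forall s t, D s -> D t -> D (mul s t)) ->
  (forall i, chi i one = 1) ->
  (forall i s t, chi i (mul s t) = chi i s * chi i t) ->
  {in r &, forall i j, i != j -> exists2 s, D s & chi i s != chi j s} ->
  uniq r -> forall c : I -> V,
  (forall s, D s -> \sum_(i <- r) chi i s *: c i = 0) ->
  {in r, forall i, c i = 0}.
Proof.
move=> D1 DM chi1 chiM; elim: r => [//|j r IHr] dist /= /andP[jr ur] c H.
have {}IHr := IHr (sub_in2 (mem_behead (s := j :: r)) dist) ur.
have cr i : i \in r -> c i = 0.
  move=> ir; have [|||s Ds ns] := dist i j; rewrite ?inE ?eqxx ?ir ?orbT //.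
    by apply: contraNneq jr => <-.
  (* The relation at [mul s t] minus [chi j s] times the one at [t] no longer contains the [j]
     term. *)
  have H' t : D t -> \sum_(i <- r) chi i t *: ((chi i s - chi j s) *: c i) = 0.
    move=> Dt; have := H t Dt; have := H _ (DM _ _ Ds Dt); rewrite !big_cons.
    move=> H1 H2; transitivity
      (chi j (mul s t) *: c j + \sum_(i <- r) chi i (mul s t) *: c i
       - chi j s *: (chi j t *: c j + \sum_(i <- r) chi i t *: c i)).
      rewrite scalerDr scalerA -chiM opprD addrACA subrr add0r scaler_sumr -sumrB.
      apply: eq_bigr => k _; rewrite chiM !scalerA -scalerBl; congr (_ *: _).
      by rewrite mulrBr [chi k t * _]mulrC [chi k t * _]mulrC.
    by rewrite H1 H2 scaler0 subr0.
  have /eqP := IHr _ H' i ir.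
  by rewrite scaler_eq0 subr_eq0 (negbTE ns) => /eqP.
move=> i; rewrite inE => /orP[/eqP ->|/cr //].
have := H one D1; rewrite big_cons chi1 scale1r big_seq big1 ?addr0 // => k kr.
by rewrite cr // scaler0.
Qed.

(* Several indices may carry the same character, so only the sum of the
   coefficients over each fibre of [a] has to vanish. *)
Lemma character_independence_fibre (K : fieldType) (V : lmodType K) (T : Type)
    (J : eqType) (I : finType) (D : T -> Prop) (one : T) (mul : T -> T -> T)
    (chi : J -> T -> K) (a : I -> J) :
  D one -> (forall s t, D s -> D t -> D (mul s t)) ->
  (forall j, chi j one = 1) ->
  (forall j s t, chi j (mul s t) = chi j s * chi j t) ->
  (forall i k, a i != a k -> exists2 s, D s & chi (a i) s != chi (a k) s) ->
  forall c : I -> V,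
  (forall s, D s -> \sum_i chi (a i) s *: c i = 0) ->
  forall j, \sum_(i | a i == j) c i = 0.
Proof.
move=> D1 DM chi1 chiM dist c H j.
have [/codomP[i0 ->]|nj] := boolP (j \in codom a); last first.
  by rewrite big1 // => i /eqP ai; rewrite -ai codom_f in nj.
pose r := undup (codom a).
have ar i : a i \in r by rewrite mem_undup; apply: codom_f.
have dist_r : {in r &, forall i j, i != j -> exists2 s, D s & chi i s != chi j s}.
  move=> j1 j2; rewrite !mem_undup => /codomP[i ->] /codomP[k ->].
  exact: dist.
apply: (character_independence D1 DM chi1 chiM dist_r (undup_uniq _)
  (c := fun j => \sum_(i | a i == j) c i) _ (ar i0)) => s Ds.
rewrite -[RHS](H s Ds).
under eq_bigr do rewrite scaler_sumr big_mkcond /=.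
rewrite exchange_big /=; apply: eq_bigr => i _.
rewrite (bigD1_seq (a i)) ?undup_uniq //= eqxx big1 ?addr0 // => k.
by rewrite eq_sym => /negbTE ->.
Qed.

(** In a full rank factorization [A = C *m R], idempotency forces [R *m C] to be the identity of
    size [\rank A], and it has the same trace as [A]. *)
Lemma mxtrace_idempotent (K : fieldType) (d : nat) (A : 'M[K]_d) :
  A *m A = A -> \tr A = (\rank A)%:R.
Proof.
move=> AA; move: (row_base_free A) (col_base_full A) (mulmx_base A).
move: (row_base A) (col_base A) => R C fR fC CR; rewrite -{1}CR mxtrace_mulC.
suff -> : R *m C = 1%:M by rewrite mxtrace1.
apply: (row_free_inj fR); apply: (row_full_inj fC).
by rewrite /= mul1mx !mulmxA CR -mulmxA CR.
Qed.

(** * Characters of the diagonal torus *)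

Section Torus.

Variables (K : fieldType) (n : nat).
Hypothesis hchar : [pchar K] =i pred0.

Definition in_torus (s : 'I_n -> K) : Prop := \prod_(i < n) s i = 1.

Definition torus_char (mu : 'rV[int]_n) (s : 'I_n -> K) : K :=
  \prod_(i < n) s i ^ mu 0 i.

Definition mnm_char (m : 'X_{1..n}) : 'rV[int]_n := \row_i (m i)%:Z.

Lemma in_torus_neq0 s i : in_torus s -> s i != 0.
Proof.
move=> Ds; have : \prod_(i < n) s i != 0 by rewrite Ds oner_neq0.
by move/prodf_neq0 => /(_ i); apply.
Qed.

Lemma in_torusM s t :
  in_torus s -> in_torus t -> in_torus (fun i => s i * t i).
Proof. by move=> Ds Dt; rewrite /in_torus big_split /= Ds Dt mulr1. Qed.

Lemma torus_char1 mu : torus_char mu (fun=> 1) = 1.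
Proof. by rewrite /torus_char big1 // => i _; rewrite exp1rz. Qed.

Lemma torus_charM mu s t :
  torus_char mu (fun i => s i * t i) = torus_char mu s * torus_char mu t.
Proof. by rewrite -big_split; apply: eq_bigr => i _; rewrite expfzMl. Qed.

Lemma torus_char_mnm m s : torus_char (mnm_char m) s = \prod_(i < n) s i ^+ m i.
Proof. by apply: eq_bigr => i _; rewrite mxE. Qed.

Lemma torus_char_eq mu nu s :
  char_eq mu nu -> in_torus s -> torus_char mu s = torus_char nu s.
Proof.
move=> [k E] Ds; have -> : mu = nu + const_mx k by rewrite -E addrC subrK.
rewrite /torus_char; under eq_bigr => i _ do
  rewrite !mxE (expfzDr _ _ (in_torus_neq0 i Ds)).
rewrite big_split /=; set q := (X in _ * X); suff -> : q = 1 by rewrite mulr1.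
rewrite /q -(big_morph (fun x : K => x ^ k) (fun x y => expfzMl x y k) (exp1rz _ k)).
by rewrite Ds exp1rz.
Qed.

Lemma natr_char0_neq0 (k : nat) : k.+1%:R != 0 :> K.
Proof. by move/pcharf0P: hchar => ->. Qed.

(** Classes of characters are determined by differences of exponents. The torus element with 2 at
    [i], its inverse at [j] and 1 elsewhere detects such a difference, because 2 has infinite order
    in characteristic zero. *)
Lemma torus_char_separated mu nu : ~ char_eq mu nu ->
  exists2 s, in_torus s & torus_char mu s != torus_char nu s.
Proof.
move=> ne; have [i [j nij]] : exists i j, mu 0 i - mu 0 j != nu 0 i - nu 0 j.
  apply: contrapT => no; apply: ne.
  case: n mu nu no => [|n'] mu' nu' no.
    by exists 0; apply/rowP => -[].
  exists (mu' 0 ord0 - nu' 0 ord0); apply/rowP => i; rewrite !mxE.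
  apply: contrapT => E; apply: no; exists i, ord0; apply/eqP => E'; apply: E.
  move: E'; move: (mu' 0 i) (mu' 0 ord0) (nu' 0 i) (nu' 0 ord0) => x y z t.
  by lia.
have ij : i != j by apply: contraNneq nij => ->; rewrite !subrr.
have two_neq0 : 2%:R != 0 :> K by apply: natr_char0_neq0.
pose s k : K := if k == i then 2%:R else if k == j then 2%:R^-1 else 1.
have sE a : torus_char a s = 2%:R ^ (a 0 i - a 0 j).
  rewrite /torus_char (bigD1 i) //= (bigD1 j) 1?eq_sym //= big1 => [|k /andP[ki kj]].
    rewrite /s eqxx eq_sym (negbTE ij) eqxx mulr1 expfzDr //.
    by rewrite exprz_inv.
  by rewrite /s (negbTE ki) (negbTE kj) exp1rz.
exists s.
  (* The character [const_mx 1] is the product of the entries, so [sE] also shows that [s] lies in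
     the torus. *)
  have := sE (const_mx 1); rewrite !mxE subrr expr0z => E1; rewrite /in_torus -[RHS]E1.
  by apply: eq_bigr => k _; rewrite mxE expr1z.
rewrite !sE; apply: contra nij; move: (_ - _) (_ - _) => x y /eqP E.
have pow2 k : (0 < k)%N -> (2%:R : K) ^+ k != 1.
  case: k => // k _; rewrite -natrX -subr_eq0 -[1]/(1%:R) -natrB ?expn_gt0 //.
  have : (0 < 2 ^ k.+1 - 1)%N by rewrite subn_gt0 (ltn_exp2l 0).
  by case: (_ - _)%N => // l _; apply: natr_char0_neq0.
have : (2%:R : K) ^ (y - x) = 1 by rewrite expfzDr // -invr_expz E mulfV ?expfz_neq0.
rewrite -subr_eq0; case: (y - x) => [[|l] //|l].
  by move=> E1; case/eqP: (pow2 l.+1 isT).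
rewrite NegzE -exprnN => /(congr1 GRing.inv); rewrite invrK invr1 => E1.
by case/eqP: (pow2 l.+1 isT).
Qed.

End Torus.

(** * Coordinates and diagonal endomorphisms *)

Section Coordinates.

Variables (K : fieldType) (W : vectType K) (d : nat) (f : d.-tuple W).
Hypothesis hf : basis_of fullv f.

Definition coord_row (w : W) : 'rV[K]_d := \row_i coord f i w.

Lemma coord_row_sum (w : W) : w = \sum_(i < d) coord_row w 0 i *: tnth f i.
Proof.
rewrite {1}(coord_basis hf (memvf w)); apply: eq_bigr => i _.
by rewrite mxE (tnth_nth 0).
Qed.

Lemma coord_row_comb (u : 'rV[K]_d) :
  coord_row (\sum_(i < d) u 0 i *: tnth f i) = u.
Proof.
apply/rowP => j; rewrite mxE.
under eq_bigr do rewrite (tnth_nth 0).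
by rewrite coord_sum_free // (basis_free hf).
Qed.

Lemma coord_row_inj : injective coord_row.
Proof. by move=> w w' E; rewrite (coord_row_sum w) E -coord_row_sum. Qed.

Lemma coord_rowZ a w : coord_row (a *: w) = a *: coord_row w.
Proof. by apply/rowP => i; rewrite !mxE linearZ. Qed.

Lemma coord_row_lfun (g : 'End(W)) (w : W) :
  coord_row (g w) = coord_row w *m lfun_mx f g.
Proof.
apply/rowP => j; rewrite {1}(coord_row_sum w) !mxE !linear_sum /=.
by apply: eq_bigr => i _; rewrite !linearZ !mxE.
Qed.

Lemma coord_row_tnth i : coord_row (tnth f i) = delta_mx 0 i.
Proof.
apply/rowP => j; rewrite !mxE (tnth_nth 0) coord_free ?(basis_free hf) //.
by rewrite eqxx eq_sym.
Qed.

Lemma lfun_mx_comp (g h : 'End(W)) :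
  lfun_mx f (g \o h)%VF = lfun_mx f h *m lfun_mx f g.
Proof.
apply/row_matrixP => i; rewrite row_mul.
have rowE (g' : 'End(W)) : row i (lfun_mx f g') = coord_row (g' (tnth f i)).
  by apply/rowP => j; rewrite !mxE.
by rewrite !rowE lfunE /= coord_row_lfun.
Qed.

Definition is_diagonal (s : 'I_d -> K) (g : 'End(W)) : Prop :=
  forall i, g (tnth f i) = s i *: tnth f i.

Lemma lfun_mx_diagonal s g :
  is_diagonal s g -> lfun_mx f g = diag_mx (\row_i s i).
Proof.
move=> gs; apply/matrixP => i j; rewrite !mxE gs linearZ /=.
have /rowP/(_ j) := coord_row_tnth i; rewrite !mxE /= => ->.
by rewrite ?eqxx /= eq_sym mulr_natr.
Qed.

Lemma is_diagonal_exists s : exists g, is_diagonal s g.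
Proof.
pose F w := \sum_(i < d) (s i * coord_row w 0 i) *: tnth f i.
have linF : linear F.
  move=> a w w'; rewrite /F scaler_sumr -big_split; apply: eq_bigr => i _ /=.
  by rewrite !mxE linearP /= scalerA -scalerDl mulrDr mulrCA.
pose lF := GRing.isLinear.Build _ _ _ _ F linF.
pose G : {linear W -> W} := HB.pack F lF.
exists (linfun G) => i; rewrite lfunE /= /F coord_row_tnth.
rewrite (bigD1 i) //= big1 => [|j /negbTE nj]; rewrite mxE.
  by rewrite !eqxx mulr1 addr0.
by rewrite nj andbF mulr0 scale0r.
Qed.

Lemma is_diagonalM s t g h : is_diagonal s g -> is_diagonal t h ->
  is_diagonal (fun i => s i * t i) (g \o h)%VF.
Proof. by move=> gs ht i; rewrite lfunE /= ht linearZ /= gs scalerA mulrC. Qed.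

Lemma in_SL_diagonal s g :
  is_diagonal s g -> (in_SL f g <-> in_torus s).
Proof.
move=> gs; rewrite /in_SL (lfun_mx_diagonal gs) det_diag /in_torus.
by under eq_bigr do rewrite mxE.
Qed.

End Coordinates.

(** * Weight projections and the weights of the representation *)

Section WeightSupport.

Variables (K : fieldType) (n : nat) (V : vectType K) (e : n.-tuple V).
Variables (d : nat) (W : vectType K) (f : d.-tuple W).
Variables (rho : 'End(V) -> 'End(W)) (S : {mpoly int[n]}).
Variable M : 'M[{mpoly K[n * n]}]_d.

Hypotheses (hchar : [pchar K] =i pred0) (hn : (0 < n)%N).
Hypotheses (he : basis_of fullv e) (hf : basis_of fullv f).
Hypotheses (hrep : is_representation e rho) (hM : represented_by e f rho M).
Hypothesis htr : has_schur_character e f rho S.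
Hypothesis hdeg : {in msupp S &, forall m m', mdeg m = mdeg m'}.

(** This expression is polynomial in arbitrary [s]; it is the matrix of [rho] when the product of
    the [s i] is 1. *)
Let torus_mx (s : 'I_n -> K) : 'M[K]_d :=
  eval_polymx idfun M (diag_mx (\row_i s i)).

Let lfun_mx_rho s g :
  is_diagonal e s g -> in_torus s -> lfun_mx f (rho g) = torus_mx s.
Proof.
move=> gs Ds; rewrite hM; first by rewrite (lfun_mx_diagonal he gs).
exact/in_SL_diagonal.
Qed.

Let torus_mxM s t : in_torus s -> in_torus t ->
  torus_mx (fun i => s i * t i) = torus_mx t *m torus_mx s.
Proof.
move=> Ds Dt; have [[g gs] [h ht]] := (is_diagonal_exists he s, is_diagonal_exists he t).
rewrite -(lfun_mx_rho (is_diagonalM gs ht) (in_torusM Ds Dt)).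
rewrite (proj2 hrep); try exact/in_SL_diagonal.
by rewrite lfun_mx_comp // (lfun_mx_rho gs) // (lfun_mx_rho ht).
Qed.

Let torus_mx_trace s : in_torus s ->
  \tr (torus_mx s) = mmap (intr : int -> K) s S.
Proof.
move=> Ds; have [g gs] := is_diagonal_exists he s.
rewrite -(lfun_mx_rho gs Ds) -(@htr K idfun g s) //; first exact/in_SL_diagonal.
rewrite (lfun_mx_diagonal he gs) map_poly_id // char_poly_trig ?diag_mx_is_trig //.
by apply: eq_bigr => i _; rewrite !mxE eqxx mulr1n.
Qed.

Let is_weightP mu : is_weight e rho mu <->
  exists2 u : 'rV[K]_d, u != 0 &
    forall s, in_torus s -> u *m torus_mx s = torus_char mu s *: u.
Proof.
split=> [[w w0 wmu]|[u u0 umu]].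
  exists (coord_row f w).
    apply: contraNneq w0 => E; apply/eqP/(coord_row_inj hf).
    by rewrite E; apply/rowP => i; rewrite !mxE linear0.
  move=> s Ds; have [g gs] := is_diagonal_exists he s.
  by rewrite -(lfun_mx_rho gs Ds) -coord_row_lfun // (wmu g s) // coord_rowZ.
exists (\sum_(i < d) u 0 i *: tnth f i).
  apply: contraNneq u0 => E; rewrite -(coord_row_comb hf u) E.
  by apply/eqP/rowP => i; rewrite !mxE linear0.
move=> g s gs Ds; apply: (coord_row_inj hf).
by rewrite coord_row_lfun // coord_rowZ coord_row_comb // (lfun_mx_rho gs Ds) umu.
Qed.

(** The entries of [M] at the generic diagonal matrix, as polynomials in its diagonal entries. *)
Let torus_poly (i j : 'I_d) : {mpoly K[n]} :=
  mmap (@mpolyC n K)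
    (fun k => mxvec (\matrix_(a, b) ('X_a *+ (a == b) : {mpoly K[n]})) 0 k) (M i j).

Let torus_mx_poly s i j : torus_mx s i j = (torus_poly i j).@[s].
Proof.
rewrite mxE /torus_poly /mmap rmorph_sum /=; apply: eq_bigr => m _.
rewrite rmorphM /= mevalC; congr (_ * _); rewrite /mmap1 rmorph_prod.
apply: eq_bigr => k _; rewrite rmorphXn; congr (_ ^+ _).
case/mxvec_indexP: k => a b; rewrite !mxvecE !mxE.
by rewrite rmorphMn /= mevalXU.
Qed.

(** One degree bound for [S] and all entries, so that every sum runs over the same finite type of
    monomials. *)
Let bound : nat :=
  maxn (msize S) (\max_i \max_j msize (torus_poly i j)).

Let mono := 'X_{1..n < bound}.

Let coef_mx (m : mono) : 'M[K]_d := \matrix_(i, j) (torus_poly i j)@_m.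

Let torus_mxE s : in_torus s ->
  torus_mx s = \sum_(m : mono) torus_char (mnm_char m) s *: coef_mx m.
Proof.
move=> Ds; apply/matrixP => i j; rewrite torus_mx_poly summxE /meval.
rewrite (@mmapE _ _ _ _ _ _ bound).
  by apply: eq_bigr => m _; rewrite !mxE torus_char_mnm mulrC.
rewrite leq_max; apply/orP; right.
by apply: leq_trans (leq_bigmax i); apply: (leq_bigmax j).
Qed.

(* Representatives of the characters modulo Z (1, ..., 1). *)
Let normal_char (mu : 'rV[int]_n) : 'rV[int]_n :=
  mu - const_mx (mu 0 (Ordinal hn)).

Let normal_charP mu nu : char_eq mu nu <-> normal_char mu = normal_char nu.
Proof.
rewrite /normal_char; split=> [[k /(canRL (subrK _)) ->]|E].
  by apply/rowP => i; rewrite !mxE opprD addrACA subrr add0r.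
exists (mu 0 (Ordinal hn) - nu 0 (Ordinal hn)).
move/rowP: E => E; apply/rowP => i; have := E i; rewrite !mxE.
move: (mu 0 i) (mu 0 _) (nu 0 i) (nu 0 _) => x y z t; lia.
Qed.

Let normal_char_eq mu : char_eq (normal_char mu) mu.
Proof.
by exists (- mu 0 (Ordinal hn)); apply/rowP => i; rewrite !mxE addrAC subrr add0r.
Qed.

Let normal_char_id mu : normal_char (normal_char mu) = normal_char mu.
Proof. exact/normal_charP/normal_char_eq. Qed.

(** Monomials differing by a power of the product of all variables agree on the torus, so a
    vanishing relation only kills the sum over each class. *)
Let torus_independence (V' : lmodType K) (I : finType) (a : I -> 'rV[int]_n)
    (c : I -> V') :
  (forall s, in_torus s -> \sum_i torus_char (a i) s *: c i = 0) ->
  forall mu, \sum_(i | normal_char (a i) == normal_char mu) c i = 0.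
Proof.
move=> H mu; apply: (character_independence_fibre (D := @in_torus K n)
  (one := fun=> 1) (mul := fun s t i => s i * t i) (chi := @torus_char K n)).
- by rewrite /in_torus big1.
- exact: in_torusM.
- exact: torus_char1.
- exact: torus_charM.
- move=> i k /eqP ik; apply: torus_char_separated => //.
  by move/normal_charP; rewrite !normal_char_id => /ik.
- move=> s Ds; rewrite -[RHS](H s Ds); apply: eq_bigr => i _; congr (_ *: _).
  exact: torus_char_eq (normal_char_eq _) Ds.
Qed.

(** The matrix coefficient of the character [mu] in the restriction of [rho] to the torus. It turns
    out to be the projection onto the weight space. *)
Let class_mx (mu : 'rV[int]_n) : 'M[K]_d :=
  \sum_(m : mono | normal_char (mnm_char m) == normal_char mu) coef_mx m.

(** The trace of [torus_mx s] has two expansions in characters of [s], one from the coefficient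
    matrices and one from [S]; independence equates their coefficients. *)
Let class_mx_trace mu :
  \tr (class_mx mu) =
  \sum_(m : mono | normal_char (mnm_char m) == normal_char mu) (S@_m)%:~R.
Proof.
rewrite raddf_sum; apply/eqP; rewrite -subr_eq0 -sumrB; apply/eqP.
apply: (@torus_independence K^o _ (fun m : mono => mnm_char m)) => s Ds.
under eq_bigr do rewrite scalerBr; rewrite sumrB.
have -> : \sum_(m : mono) torus_char (mnm_char m) s *: (\tr (coef_mx m) : K^o) =
    \tr (torus_mx s).
  by rewrite torus_mxE // raddf_sum; apply: eq_bigr => m _; rewrite /= mxtraceZ.
rewrite torus_mx_trace // (@mmapE _ _ _ _ _ _ bound) ?leq_maxl //.
rewrite -sumrB big1 // => m _.
by rewrite /mmap1 -torus_char_mnm mulrC subrr.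
Qed.

(** With [t] fixed, compare the coefficients of the characters of [s] in the multiplicativity
    relation for [torus_mx]. *)
Let class_mx_eigen mu t : in_torus t ->
  class_mx mu *m torus_mx t = torus_char mu t *: class_mx mu.
Proof.
move=> Dt; apply/eqP; rewrite -subr_eq0 mulmx_suml scaler_sumr -sumrB; apply/eqP.
pose c (m : mono) := coef_mx m *m torus_mx t - torus_char (mnm_char m) t *: coef_mx m.
rewrite -[RHS](torus_independence (c := c) (a := fun m : mono => mnm_char m) _ mu).
  apply: eq_bigr => m /eqP/normal_charP E; rewrite /c.
  by rewrite (torus_char_eq E Dt).
move=> s Ds; rewrite /c.
under eq_bigr do rewrite scalerBr scalerA mulrC -torus_charM scalemxAl.
rewrite sumrB -mulmx_suml -torus_mxE // -torus_mxE; last exact: in_torusM.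
by rewrite torus_mxM // subrr.
Qed.

(** Expanding [X *m torus_mx s] in characters of [s] gives [X] as the coefficient of [mu]. With [X]
    equal to [class_mx mu] this is idempotency. *)
Let class_mx_absorb p (X : 'M[K]_(p, d)) mu :
  (forall s, in_torus s -> X *m torus_mx s = torus_char mu s *: X) ->
  X *m class_mx mu = X.
Proof.
move=> HX; apply/eqP; rewrite -subr_eq0; apply/eqP.
(* The extra index carries the right-hand side, so that the equation becomes a single vanishing
   relation. *)
pose a (i : mono + unit) := if i is inl m then mnm_char m else mu.
pose c (i : mono + unit) := if i is inl m then X *m coef_mx m else - X.
rewrite -[RHS](torus_independence (c := c) (a := a) _ mu).
  by rewrite big_sumType /= mulmx_sumr (big_pred1 tt) // => -[]; rewrite eqxx.
move=> s Ds; rewrite big_sumType /= (big_pred1 tt) => [|[] //].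
under eq_bigr do rewrite scalemxAr.
by rewrite -mulmx_sumr -torus_mxE // HX // scalerN subrr.
Qed.

(** A weight vector is fixed by [class_mx mu], which is then a nonzero idempotent and has nonzero
    trace in characteristic zero. Conversely, homogeneity leaves at most one monomial of [S] in a
    class, so its coefficient is the trace and cannot cancel. *)
Lemma is_weight_msupp mu : is_weight e rho mu <->
  exists2 m, m \in msupp S & char_eq mu (mnm_char m).
Proof.
rewrite is_weightP; split=> [[u u0 umu]|[N NS muN]].
  have C0 : class_mx mu != 0.
    by apply: contraNneq u0 => C0; rewrite -(class_mx_absorb umu) C0 mulmx0.
  have : \tr (class_mx mu) != 0.
    rewrite mxtrace_idempotent; last exact/class_mx_absorb/class_mx_eigen.
    by move/pcharf0P: hchar => ->; rewrite mxrank_eq0.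
  rewrite class_mx_trace => nz; apply: contrapT => no; move/eqP: nz; apply.
  rewrite big1 // => m /eqP/esym/normal_charP E.
  have [mS|/memN_msupp_eq0 -> //] := boolP ((m : 'X_{1..n}) \in msupp S).
  by case: no; exists (m : 'X_{1..n}).
have C0 : class_mx mu != 0.
  have SN : (S@_N)%:~R != 0 :> K.
    have : S@_N != 0 by rewrite -mcoeff_msupp.
    case: (S@_N) => k; first by rewrite -pmulrn; move/pcharf0P: hchar => ->.
    by move=> _; rewrite NegzE mulrNz oppr_eq0; apply: (natr_char0_neq0 hchar).
  apply: contra_neq SN => C0; have := class_mx_trace mu; rewrite C0 mxtrace0.
  have ltN : (mdeg N < bound)%N by rewrite leq_max (msize_mdeg_lt NS).
  rewrite (bigD1 (BMultinom ltN)) /=; last by apply/eqP/esym/normal_charP.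
  rewrite big1 ?addr0 => [->//|m /andP[/eqP/normal_charP mmu nm]].
  have [mS|/memN_msupp_eq0 -> //] := boolP ((m : 'X_{1..n}) \in msupp S).
  case/eqP: nm; apply/val_inj/mnmP => /= i.
  have [k] : char_eq (mnm_char m) (mnm_char N).
    by apply/normal_charP; rewrite -(proj1 (normal_charP _ _) muN);
       apply/normal_charP.
  move=> /rowP E; have Ej j : (m j)%:Z = (N j)%:Z + k.
    by have := E j; rewrite !mxE; move: (Posz _) (Posz _) => x y; lia.
  (* Two monomials of equal degree that differ by the constant [k] satisfy [k *+ n = 0]. *)
  have k0 : k = 0.
    have : (mdeg m)%:Z = (mdeg N)%:Z + k *+ n.
      have -> : k *+ n = \sum_(i < n) k by rewrite sumr_const card_ord.
      rewrite !mdegE !(big_morph Posz PoszD (erefl _)) -big_split /=.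
      by apply: eq_bigr => j _; apply: Ej.
    rewrite (hdeg mS NS) => /eqP; rewrite addrC -subr_eq subrr eq_sym.
    by rewrite mulrn_eq0 eqn0Ngt hn => /eqP.
  by have := Ej i; rewrite k0 addr0 => -[].
(* By [class_mx_eigen], any nonzero row of [class_mx mu] is a weight vector. *)
have [i ui] : exists i, row i (class_mx mu) != 0.
  apply: contrapT => no; case/eqP: C0; apply/row_matrixP => i; rewrite row0.
  by apply: contrapT => /eqP ri; apply: no; exists i.
exists (row i (class_mx mu)) => // s Ds.
by rewrite -row_mul class_mx_eigen // linearZ.
Qed.

End WeightSupport.

(** * Root bases attached to orderings of the coordinates *)

Section RootBasis.

Variables (n : nat) (s : 'S_n.+1).
Implicit Types x y : 'rV[int]_n.+1.

(** The two casts embed [k] and [k.+1] into ['I_n.+1], so this is the k-th simple root for the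
    ordering [s]. *)
Definition simple_pair (k : 'I_n) : 'I_n.+1 * 'I_n.+1 :=
  (s (widen_ord (leqnSn n) k), s (lift ord0 k)).

Definition simple_pairs : {set 'I_n.+1 * 'I_n.+1} := [set simple_pair k | k : 'I_n].

(** The pairing with a fundamental coweight: on vectors of sum 0, [prefix_coord k.+1] reads off the
    coefficient of the k-th simple root. *)
Definition prefix_coord (k : nat) (x : 'rV[int]_n.+1) : int :=
  \sum_(i < n.+1 | (i < k)%N) x 0 (s i).

Lemma simple_pair_inj : injective simple_pair.
Proof. by move=> k l [/perm_inj/(congr1 val) /= E _]; apply: val_inj. Qed.

Lemma sum_simple_pairs (U : nmodType) (F : 'I_n.+1 * 'I_n.+1 -> U) :
  \sum_(p in simple_pairs) F p = \sum_(k < n) F (simple_pair k).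
Proof.
rewrite big_imset /=; first by apply: eq_bigl => k; rewrite inE.
by move=> k l _ _; apply: simple_pair_inj.
Qed.

Lemma prefix_coordD k x y :
  prefix_coord k (x + y) = prefix_coord k x + prefix_coord k y.
Proof. by rewrite /prefix_coord -big_split; apply: eq_bigr => i _; rewrite mxE. Qed.

Lemma prefix_coordN k x : prefix_coord k (- x) = - prefix_coord k x.
Proof. by rewrite /prefix_coord -sumrN; apply: eq_bigr => i _; rewrite mxE. Qed.

Lemma prefix_coord0 k : prefix_coord k 0 = 0.
Proof. by rewrite /prefix_coord big1 // => i _; rewrite mxE. Qed.

Lemma prefix_coordZ k x a : prefix_coord k (x *~ a) = prefix_coord k x * a.
Proof.
rewrite /prefix_coord mulr_suml; apply: eq_bigr => i _.
by rewrite -scaler_int mxE intz mulrC.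
Qed.

Lemma prefix_coord_sum (I : Type) (r : seq I) (F : I -> 'rV[int]_n.+1) k :
  prefix_coord k (\sum_(i <- r) F i) = \sum_(i <- r) prefix_coord k (F i).
Proof. by apply: big_morph; [exact: prefix_coordD | exact: prefix_coord0]. Qed.

Lemma prefix_coordS (i : 'I_n.+1) x :
  prefix_coord i.+1 x = prefix_coord i x + x 0 (s i).
Proof.
rewrite /prefix_coord (bigD1 i) //= addrC; congr (_ + _).
apply: eq_bigl => j; rewrite ltnS leq_eqVlt -(inj_eq val_inj) /=.
by case: ltngtP.
Qed.

Lemma prefix_coord_inj x y :
  (forall k, (k <= n.+1)%N -> prefix_coord k x = prefix_coord k y) -> x = y.
Proof.
move=> E; apply/rowP => i; rewrite -(permKV s i); move: (s^-1%g i) => j.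
have := E j.+1 (ltn_ord j); rewrite !prefix_coordS E ?(ltnW (ltn_ord j)) //.
exact: addrI.
Qed.

Lemma prefix_coord_full x : prefix_coord n.+1 x = \sum_i x 0 i.
Proof.
rewrite [RHS](reindex_inj (@perm_inj _ s)) /=.
by apply: eq_bigl => i; rewrite ltn_ord.
Qed.

Lemma prefix_coord_root (k : nat) (a b : 'I_n.+1) :
  prefix_coord k (root_vec (s a, s b)) = (a < k)%N%:R - (b < k)%N%:R.
Proof.
have delta c : prefix_coord k (delta_mx 0 (s c)) = (c < k)%N%:R.
  rewrite /prefix_coord big_mkcond (bigD1 c) //= big1 => [|i /negbTE ic].
    by rewrite mxE !eqxx addr0; case: ltnP.
  by rewrite mxE (inj_eq perm_inj) ic andbF if_same.
by rewrite /root_vec prefix_coordD prefix_coordN !delta.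
Qed.

Lemma prefix_coord_simple_comb (c : 'I_n -> int) (l : nat) :
  prefix_coord l (\sum_(k < n) root_vec (simple_pair k) *~ c k) =
  \sum_(k < n | k.+1 == l) c k.
Proof.
rewrite prefix_coord_sum [RHS]big_mkcond; apply: eq_bigr => k _.
rewrite prefix_coordZ prefix_coord_root /= /bump leq0n add1n.
by case: (ltngtP k.+1 l) => _; rewrite ?subrr ?subr0 ?mul0r ?mul1r.
Qed.

Lemma sum_root_vec (p : 'I_n.+1 * 'I_n.+1) : \sum_i root_vec p 0 i = 0.
Proof.
case: p => a b; rewrite -(permKV s a) -(permKV s b) -prefix_coord_full.
by rewrite prefix_coord_root !ltn_ord subrr.
Qed.

(** Summation by parts. The k-th simple root has prefix coordinate 1 at [k.+1] and 0 elsewhere, so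
    both sides have the same prefix coordinates; at [n.+1] this is the hypothesis on the sum. *)
Lemma simple_expansion x : \sum_i x 0 i = 0 ->
  x = \sum_(k < n) root_vec (simple_pair k) *~ prefix_coord k.+1 x.
Proof.
move=> x0; apply: prefix_coord_inj => -[|l]; rewrite prefix_coord_simple_comb.
  by move=> _; rewrite big1 // /prefix_coord big1.
rewrite ltnS leq_eqVlt => /orP[/eqP ->|ln].
  rewrite prefix_coord_full x0 big1 // => k; rewrite eqSS => /eqP kn.
  by have := ltn_ord k; rewrite kn ltnn.
by rewrite (big_pred1 (Ordinal ln)) // => k; rewrite /= eqSS.
Qed.

Lemma nonneg_comb_prefix x : \sum_i x 0 i = 0 ->
  (forall k, 0 <= prefix_coord k x) -> nonneg_comb simple_pairs x.
Proof.
(* The index of a simple pair is recovered from its first component by [s^-1]; the final 0 is the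
   constant in [char_eq]. *)
move=> x0 xge0; exists (fun p => `|prefix_coord (s^-1%g p.1).+1 x|%N); exists 0.
rewrite sum_simple_pairs {1}(simple_expansion x0).
rewrite (_ : const_mx 0 = 0) //; apply/eqP; rewrite subr_eq0; apply/eqP.
apply: eq_bigr => k _; rewrite /= permK pmulrn; congr (_ *~ _).
by rewrite /= gez0_abs.
Qed.

Lemma const_mx_sum0 (x : 'rV[int]_n.+1) k :
  x = const_mx k -> \sum_i x 0 i = 0 -> k = 0.
Proof.
move=> ->; under eq_bigr do rewrite mxE.
by rewrite sumr_const card_ord => /eqP; rewrite mulrn_eq0 => /eqP.
Qed.

Lemma simple_pairs_root_basis : is_root_basis simple_pairs.
Proof.
split.
- apply/fintype.subsetP => p /imsetP[k _ ->]; rewrite inE (inj_eq perm_inj).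
  by rewrite -(inj_eq val_inj) /= neq_ltn /bump leq0n add1n ltnSn.
- move=> c [a]; rewrite subr0 sum_simple_pairs => E p /imsetP[k _ ->].
  (* Independence is tested modulo constant vectors, but a combination of roots has coordinate sum
     0, which excludes a nonzero constant. *)
  have a0 : a = 0.
    apply: (const_mx_sum0 E); rewrite -prefix_coord_full prefix_coord_simple_comb.
    by rewrite big1 // => l; rewrite eqSS => /eqP ln; have := ltn_ord l; rewrite ln ltnn.
  have := congr1 (prefix_coord k.+1) E.
  rewrite prefix_coord_simple_comb (big_pred1 k) => [->|l]; last first.
    by rewrite /= eqSS.
  by rewrite a0 (_ : const_mx 0 = 0) // prefix_coord0.
- have le_root (a b : 'I_n.+1) : (a < b)%N ->
      nonneg_comb simple_pairs (root_vec (s a, s b)).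
    move=> ab; apply: nonneg_comb_prefix; first exact: sum_root_vec.
    move=> k; rewrite prefix_coord_root subr_ge0 ler_nat.
    by case: ltnP => // bk; rewrite (ltn_trans ab bk).
  move=> [i j]; rewrite inE /= -(permKV s i) -(permKV s j) (inj_eq perm_inj).
  rewrite -(inj_eq val_inj) neq_ltn => /orP[] ab; [left|right]; last first.
    by rewrite /root_vec opprB; apply: (le_root _ _ ab).
  exact: le_root.
Qed.

(** Such an [x] is a nonnegative combination of simple roots, each of which is nonnegative on a [w]
    decreasing along [s]. *)
Lemma char_eval_prefix_ge0 (R : realType) (w : 'rV[R]_n.+1) x :
  (forall a b : 'I_n.+1, (a <= b)%N -> w 0 (s b) <= w 0 (s a)) ->
  \sum_i x 0 i = 0 -> (forall k, 0 <= prefix_coord k x) -> 0 <= char_eval x w.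
Proof.
move=> wdec x0 xge0; rewrite (simple_expansion x0) /char_eval.
under eq_bigr do rewrite summxE rmorph_sum mulr_suml.
rewrite exchange_big /=; apply: sumr_ge0 => k _.
have -> : \sum_(i < n.+1)
      ((root_vec (simple_pair k) *~ prefix_coord k.+1 x) 0 i)%:~R * w 0 i =
    (prefix_coord k.+1 x)%:~R * (w 0 (simple_pair k).1 - w 0 (simple_pair k).2) :> R.
  transitivity (\sum_(i < n.+1) (prefix_coord k.+1 x)%:~R *
      ((i == (simple_pair k).1)%:R * w 0 i - (i == (simple_pair k).2)%:R * w 0 i)).
    apply: eq_bigr => i _; rewrite -scaler_int !mxE intz rmorphM -mulrA; congr (_ * _).
    by rewrite rmorphB /= !rmorph_nat mulrBl ?eqxx.
  have pick j : \sum_(i < n.+1) (i == j)%:R * w 0 i = w 0 j.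
    rewrite (bigD1 j) //= eqxx mul1r big1 ?addr0 // => i /negbTE ->.
    by rewrite mul0r.
  by rewrite -mulr_sumr sumrB !pick.
apply: mulr_ge0; first by rewrite ler0z.
by rewrite subr_ge0; apply: wdec; rewrite /= /bump leq0n add1n.
Qed.

End RootBasis.

(** * Normal cones of the Newton polytope *)

Section NormalFan.

Variables (R : realType) (n : nat) (S : {mpoly int[n]}).
Hypothesis hdeg : {in msupp S &, forall m m', mdeg m = mdeg m'}.
Hypothesis S_neq0 : S != 0.

Definition mnm_eval (x : 'rV[R]_n) (m : 'X_{1..n}) : R :=
  \sum_(i < n) x 0 i * (m i)%:R.

Definition mnm_top (x : 'rV[R]_n) (m : 'X_{1..n}) : Prop :=
  forall m', m' \in msupp S -> mnm_eval x m' <= mnm_eval x m.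

Definition normal_cell (w : 'rV[R]_n) : set 'rV[R]_n :=
  [set x | apartment x /\
     forall m, m \in msupp S -> mnm_top w m -> mnm_top x m].

Definition vertex_cone (u : 'X_{1..n}) : set 'rV[R]_n :=
  [set x | apartment x /\ mnm_top x u].

Lemma mnm_evalD x y m : mnm_eval (x + y) m = mnm_eval x m + mnm_eval y m.
Proof. by rewrite -big_split; apply: eq_bigr => i _; rewrite mxE mulrDl. Qed.

Lemma mnm_evalZ a x m : mnm_eval (a *: x) m = a * mnm_eval x m.
Proof. by rewrite mulr_sumr; apply: eq_bigr => i _; rewrite mxE mulrA. Qed.

Lemma mnm_eval0 m : mnm_eval 0 m = 0.
Proof. by apply: big1 => i _; rewrite mxE mul0r. Qed.

Lemma mnm_eval_const a m : mnm_eval (const_mx a) m = a * (mdeg m)%:R.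
Proof.
rewrite mdegE natr_sum mulr_sumr; apply: eq_bigr => i _.
by rewrite mxE.
Qed.

(** All monomials of [S] have the same degree, so a constant vector shifts all their values equally.
    This lets the cells descend to the quotient. *)
Lemma mnm_topB_const a x m : m \in msupp S ->
  mnm_top (x - const_mx a) m <-> mnm_top x m.
Proof.
move=> mS; have E m' : m' \in msupp S ->
    mnm_eval (x - const_mx a) m' = mnm_eval x m' - a * (mdeg m)%:R.
  move=> m'S; rewrite mnm_evalD -scaleN1r mnm_evalZ mnm_eval_const mulN1r.
  by rewrite (hdeg m'S mS).
by split=> top m' m'S; have := top m' m'S; rewrite !E // lerD2r.
Qed.

Lemma mnm_top_exists x : exists2 m, m \in msupp S & mnm_top x m.
Proof.
have : msupp S != [::] by rewrite msupp_eq0.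
rewrite /mnm_top; elim: (msupp S) => [//|m s IHs] _.
case: s IHs => [_|m' s /(_ isT)[m0 m0s top]].
  by exists m; rewrite ?mem_head // => m'; rewrite inE => /eqP ->.
have [le|/ltW le] := lerP (mnm_eval x m) (mnm_eval x m0).
  exists m0; first by rewrite in_cons m0s orbT.
  by move=> k; rewrite in_cons => /orP[/eqP -> //|/top].
exists m; first by rewrite mem_head.
by move=> k; rewrite in_cons => /orP[/eqP -> //|/top/le_trans]; apply.
Qed.

Lemma mnm_top_eq x m m' : m \in msupp S -> m' \in msupp S ->
  mnm_top x m -> mnm_top x m' <-> mnm_eval x m' = mnm_eval x m.
Proof.
move=> mS m'S top; split=> [top'|E]; first by apply/eqP; rewrite eq_le top ?top'.
by move=> k kS; rewrite E; apply: top.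
Qed.

(** * Cells of the polyhedral complex *)

Section Polytope.

Variables (K : fieldType) (v : K -> R).
Hypothesis hcoef : forall m, S@_m != 0 -> v (S@_m)%:~R = 0.

Let P := newton_polytope v S.

(** The coefficients have valuation zero, so the zeroth coordinate of a Newton point is 0. *)
Let dotv_newton_point w m : m \in msupp S ->
  dotv w (newton_point v S m) = mnm_eval (rsubmx w) m.
Proof.
rewrite mcoeff_msupp => mS; rewrite /dotv big_split_ord /= big1 => [|i _].
  by rewrite add0r; apply: eq_bigr => i _; rewrite row_mxEr !mxE.
by rewrite row_mxEl mxE hcoef // oppr0 mulr0.
Qed.

Let dotv_sum w (t : 'X_{1..n} -> R) :
  dotv w (\sum_(m <- msupp S) t m *: newton_point v S m) =
  \sum_(m <- msupp S) t m * mnm_eval (rsubmx w) m.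
Proof.
rewrite /dotv; under eq_bigr do rewrite summxE mulr_sumr.
rewrite exchange_big; apply: eq_big_seq => m mS /=.
rewrite -dotv_newton_point // mulr_sumr; apply: eq_bigr => i _.
by rewrite mxE mulrCA.
Qed.

Let newton_point_in m : m \in msupp S -> P (newton_point v S m).
Proof.
move=> mS; exists (fun k => (k == m)%:R); split.
- by move=> k _; rewrite ler0n.
- rewrite (bigD1_seq m) ?msupp_uniq //= eqxx big1 ?addr0 // => k /negbTE ->.
  by [].
- rewrite (bigD1_seq m) ?msupp_uniq //= eqxx scale1r big1 ?addr0 // => k /negbTE ->.
  by rewrite scale0r.
Qed.

Let dotv_le w c y : P y ->
  (forall m, m \in msupp S -> mnm_eval (rsubmx w) m <= c) -> dotv w y <= c.
Proof.
move=> [t [t0 t1 ->]] le; rewrite dotv_sum -[c]mul1r -t1 mulr_suml.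
rewrite big_seq [leRHS]big_seq; apply: ler_sum => m mS.
by apply: ler_wpM2l; [exact: t0 | exact: le].
Qed.

Let newton_point_max w m : m \in msupp S -> mnm_top (rsubmx w) m ->
  maximizers w P (newton_point v S m).
Proof.
move=> mS top; split; first exact: newton_point_in.
by move=> z Pz; rewrite dotv_newton_point //; apply: dotv_le.
Qed.

(** A face of a convex hull is spanned by the generators it contains, so its normal cone is tested
    on the monomials maximal for [w]. *)
Lemma complex_cell_maximizers w x :
  complex_cell v S (maximizers w P) x <->
  forall m, m \in msupp S -> mnm_top (rsubmx w) m -> mnm_top x m.
Proof.
set X : 'rV[R]_(1 + n) := row_mx (const_mx (- 1)) x.
have rX : rsubmx X = x by rewrite row_mxKr.
split=> [cell m mS top m' m'S|H y [Py maxy]].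
  have [_ /(_ _ (newton_point_in m'S))] := cell _ (newton_point_max mS top).
  by rewrite !dotv_newton_point // rX.
have [m0 m0S top0] := mnm_top_exists (rsubmx w).
split=> // z Pz; apply: (@le_trans _ _ (mnm_eval x m0)).
  by apply: dotv_le => // m mS; rewrite rX; apply: H.
have {maxy} := maxy _ (newton_point_in m0S).
have [t [t0 t1 ->]] := Py; rewrite dotv_newton_point // !dotv_sum rX => le.
(* A maximizer puts no mass on monomials that are not maximal for [w]: these nonnegative terms have
   sum at most 0. *)
have tight m : m \in msupp S ->
    t m * (mnm_eval (rsubmx w) m0 - mnm_eval (rsubmx w) m) = 0.
  have ge0 k : k \in msupp S ->
      0 <= t k * (mnm_eval (rsubmx w) m0 - mnm_eval (rsubmx w) k).
    by move=> kS; rewrite mulr_ge0 ?t0 // subr_ge0 top0.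
  move=> mS; apply/eqP; rewrite eq_le ge0 // andbT.
  apply: (@le_trans _ _ (\sum_(k <- msupp S)
      t k * (mnm_eval (rsubmx w) m0 - mnm_eval (rsubmx w) k))).
    rewrite (bigD1_seq m) ?msupp_uniq //= lerDl big_seq_cond sumr_ge0 // => k.
    by case/andP => kS _; apply: ge0.
  under eq_bigr do rewrite mulrBr.
  by rewrite sumrB -mulr_suml t1 mul1r subr_le0.
rewrite -[leLHS]mul1r -t1 mulr_suml big_seq [leRHS]big_seq.
apply: ler_sum => m mS; have /eqP := tight m mS.
rewrite mulf_eq0 subr_eq0 => /orP[/eqP ->|/eqP E]; first by rewrite !mul0r.
by apply: ler_wpM2l; [exact: t0 | apply: H => // k kS; rewrite -E; apply: top0].
Qed.

Lemma to_apartment_in (x : 'rV[R]_n) : (0 < n)%N -> apartment (to_apartment x).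
Proof.
move=> n0; rewrite /apartment /to_apartment /=; under eq_bigr do rewrite !mxE.
rewrite sumrB sumr_const card_ord -[X in _ - X]mulr_natr divfK ?subrr //.
by rewrite pnatr_eq0 -lt0n.
Qed.

Lemma to_apartment_id (x : 'rV[R]_n) : apartment x -> to_apartment x = x.
Proof.
rewrite /apartment /to_apartment /= => ->; rewrite mul0r.
by apply/rowP => i; rewrite !mxE subr0.
Qed.

(** Cells are invariant under constant vectors, so the image of a cell is its intersection with the
    apartment. *)
Lemma poly_complex_image : (0 < n)%N ->
  [set to_apartment @` C | C in poly_complex v S] = range normal_cell.
Proof.
move=> n0; have image w :
    to_apartment @` complex_cell v S (maximizers w P) = normal_cell (rsubmx w).
  apply/seteqP; split=> [_ [x /complex_cell_maximizers H <-]|x [xA H]].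
    split; first exact: to_apartment_in.
    by move=> m mS top; apply/mnm_topB_const => //; apply: H.
  by exists x; [exact/complex_cell_maximizers | exact: to_apartment_id].
apply/seteqP; split=> [_ [_ [F [_ [w ->]] ->] <-]|_ [w _ <-]].
  by exists (rsubmx w).
(* Any zeroth coordinate would give the same face of the polytope; 0 is chosen. *)
have E : normal_cell w =
    to_apartment @` complex_cell v S (maximizers (row_mx (0 : 'rV_1) w) P).
  by rewrite image row_mxKr.
rewrite E; eexists; last by [].
exists (maximizers (row_mx (0 : 'rV_1) w) P) => //; split; last by eexists.
have [m mS top] := mnm_top_exists w.
by exists (newton_point v S m); apply: newton_point_max; rewrite ?row_mxKr.
Qed.

End Polytope.

End NormalFan.

(** * Faces of the vertex cones and normal cells *)

Section Faces.

Variables (R : realType) (n : nat) (S : {mpoly int[n]}).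

Lemma dotvD m (w x y : 'rV[R]_m) : dotv w (x + y) = dotv w x + dotv w y.
Proof. by rewrite -big_split; apply: eq_bigr => i _; rewrite mxE mulrDr. Qed.

Lemma dotvZ m a (w x : 'rV[R]_m) : dotv w (a *: x) = a * dotv w x.
Proof. by rewrite mulr_sumr; apply: eq_bigr => i _; rewrite mxE mulrCA. Qed.

Lemma vertex_coneD u (x y : 'rV[R]_n) :
  vertex_cone S u x -> vertex_cone S u y -> vertex_cone S u (x + y).
Proof.
move=> [xA xtop] [yA ytop]; split.
  rewrite /apartment /=; under eq_bigr do rewrite mxE.
  by rewrite big_split /= xA yA addr0.
by move=> m mS; rewrite !mnm_evalD lerD // ?xtop ?ytop.
Qed.

Lemma vertex_cone0 u : vertex_cone S u (0 : 'rV[R]_n).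
Proof.
split; first by rewrite /apartment /= big1 // => i _; rewrite mxE.
by move=> m mS; rewrite !mnm_eval0.
Qed.

(** A linear form attaining a maximum on a cone has maximum 0: doubling a maximizer bounds the value
    above by 0, and the origin bounds it below. *)
Lemma maximizers_vertex_cone u (w : 'rV[R]_n) : maximizers w (vertex_cone S u) !=set0 ->
  (forall z, vertex_cone S u z -> dotv w z <= 0) /\
  maximizers w (vertex_cone S u) = [set x | vertex_cone S u x /\ dotv w x = 0].
Proof.
move=> [x [Cx maxx]].
have w0 : dotv w (0 : 'rV[R]_n) = 0 by apply: big1 => i _; rewrite mxE mulr0.
have x0 : dotv w x = 0.
  apply/eqP; rewrite eq_le -{2}w0 maxx ?andbT; last exact: vertex_cone0.
  by have := maxx _ (vertex_coneD Cx Cx); rewrite dotvD gerDl.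
have le0 z : vertex_cone S u z -> dotv w z <= 0 by move=> /maxx; rewrite x0.
split=> //; apply/seteqP; split=> [y [Cy maxy]|y [Cy y0]].
  by split=> //; apply/eqP; rewrite eq_le le0 //= -{1}x0 maxy.
by split=> // z /le0; rewrite y0.
Qed.

(* The point [x0] lies in the relative interior of the face. *)
Lemma face_interior_point u (G : set 'rV[R]_n) : G !=set0 ->
  (forall x y, G x -> G y -> G (x + y)) -> G `<=` vertex_cone S u ->
  exists2 x0, G x0 & forall m x, m \in msupp S -> G x ->
    mnm_eval x0 m = mnm_eval x0 u -> mnm_eval x m = mnm_eval x u.
Proof.
move=> [y Gy] GD GC.
suff H (r : seq 'X_{1..n}) : {subset r <= msupp S} -> exists2 x0, G x0 &
    forall m x, m \in r -> G x ->
    mnm_eval x0 m = mnm_eval x0 u -> mnm_eval x m = mnm_eval x u by exact: H.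
elim: r => [_|m r IHr rS]; first by exists y.
have [|x0 Gx0 H0] := IHr; first by move=> k kr; rewrite rS // in_cons kr orbT.
have mS : m \in msupp S by rewrite rS ?mem_head.
(* If [m] differs from [u] somewhere on [G], a point [x1] showing this is added to [x0]. An
   inequality tight at the sum is tight at both summands. *)
have [Hm|] := EM (forall x, G x -> mnm_eval x m = mnm_eval x u).
  by exists x0 => // k x; rewrite in_cons => /orP[/eqP -> /Hm|/H0]; auto.
move/existsNP => [x1 /not_implyP[Gx1 ne1]].
exists (x0 + x1) => [|k x kr Gx]; first exact: GD.
have kS : k \in msupp S by exact: rS.
have [[_ t0] [_ t1]] := (GC _ Gx0, GC _ Gx1).
have := t0 k kS; have := t1 k kS; rewrite !mnm_evalD => le1 le0 E.
have [E0 E1] : mnm_eval x0 k = mnm_eval x0 u /\ mnm_eval x1 k = mnm_eval x1 u.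
  by split; lra.
move: kr; rewrite in_cons => /orP[/eqP km|kr]; last exact: H0 kr Gx E0.
by case: ne1; rewrite -km.
Qed.

(** This provides a step small enough to move from a relative interior point against a given
    direction without leaving the cone. *)
Lemma scaling_exists (I : eqType) (r : seq I) (a b : I -> R) :
  {in r, forall i, 0 <= a i /\ 0 <= b i} -> {in r, forall i, a i = 0 -> b i = 0} ->
  exists2 eps, 0 < eps & {in r, forall i, eps * b i <= a i}.
Proof.
elim: r => [_ _|i r IHr ge0 ab0]; first by exists 1.
have [||eps eps0 H] := IHr.
- by move=> k kr; apply: ge0; rewrite in_cons kr orbT.
- by move=> k kr; apply: ab0; rewrite in_cons kr orbT.
have [ai0 bi0] := ge0 i (mem_head _ _).
have [eps1 eps10 Hi] : exists2 eps1, 0 < eps1 & eps1 * b i <= a i.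
  have [a0|a0] := eqVneq (a i) 0.
    by exists 1; rewrite ?ltr01 // (ab0 i (mem_head _ _) a0) mulr0.
  have b1 : 0 < b i + 1 by lra.
  (* Adding 1 keeps the denominator positive, and [b i / (b i + 1)] is at most 1. *)
  exists (a i / (b i + 1)); first by rewrite divr_gt0 // lt_def a0.
  by rewrite mulrAC ler_pdivrMr // ler_wpM2l //; lra.
exists (Num.min eps eps1); first by rewrite lt_min eps0.
move=> k; rewrite in_cons => /orP[/eqP ->|kr].
  by apply: le_trans Hi; apply: ler_wpM2r => //; rewrite ge_min lexx orbT.
apply: le_trans (H k kr); apply: ler_wpM2r; last by rewrite ge_min lexx.
by have [] := ge0 k _; rewrite // in_cons kr orbT.
Qed.

(** The face is the normal cell of a relative interior point [x0], where as few inequalities as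
    possible are tight. *)
Lemma vertex_cone_face u (G : set 'rV[R]_n) : u \in msupp S ->
  is_face G (vertex_cone S u) -> exists w, G = normal_cell S w.
Proof.
move=> uS [G0 [w Gw]]; move: G0; rewrite Gw => G0.
have [le0 GE] := maximizers_vertex_cone G0; rewrite GE in G0 *.
have [||x0 [Cx0 wx0] H0] := face_interior_point G0 (u := u).
- move=> x y [Cx wx] [Cy wy]; split; first exact: vertex_coneD.
  by rewrite dotvD wx wy addr0.
- by move=> x [].
have top0 : mnm_top S x0 u by case: Cx0.
exists x0; apply/seteqP; split=> [x [Cx wx]|x [xA xtop]].
  split; first by case: Cx.
  move=> m mS /(mnm_top_eq uS mS top0) E.
  by apply/(mnm_top_eq uS mS (proj2 Cx)); apply: H0.
have topu : mnm_top S x u by exact: xtop.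
split=> //; apply/eqP; rewrite eq_le le0 //=.
have [||eps eps0 Heps] := @scaling_exists _ (msupp S)
  (fun m => mnm_eval x0 u - mnm_eval x0 m) (fun m => mnm_eval x u - mnm_eval x m).
- by move=> m mS; rewrite !subr_ge0 top0 ?topu.
- move=> m mS /eqP; rewrite subr_eq0 eq_sym => /eqP/(mnm_top_eq uS mS top0).
  by move=> /(xtop m mS)/(mnm_top_eq uS mS topu) ->; rewrite subrr.
(* Since [x0 - eps x] stays in the cone and [w] vanishes at [x0], the form [w] is nonnegative at
   [x]. *)
have /le0 : vertex_cone S u (x0 + (- eps) *: x).
  split.
    rewrite /apartment /=; under eq_bigr do rewrite !mxE.
    by rewrite big_split /= -mulr_sumr (proj1 Cx0) xA mulr0 addr0.
  by move=> m mS; have := Heps m mS; rewrite !mnm_evalD !mnm_evalZ; lra.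
by rewrite dotvD dotvZ wx0 add0r mulNr oppr_le0 pmulr_rge0.
Qed.

(** Each [m - u] is nonpositive on the cone of [u], so their sum [g] attains its maximum 0 exactly
    where every [m] maximal for [w] ties with [u]. *)
Lemma normal_cell_face u (w : 'rV[R]_n) : u \in msupp S -> mnm_top S w u ->
  is_face (normal_cell S w) (vertex_cone S u).
Proof.
move=> uS topu.
pose rowm (m : 'X_{1..n}) : 'rV[R]_n := \row_i (m i)%:R.
pose g := \sum_(m <- msupp S | `[<mnm_top S w m>]) (rowm m - rowm u).
have gE x : dotv g x =
    \sum_(m <- msupp S | `[<mnm_top S w m>]) (mnm_eval x m - mnm_eval x u).
  rewrite /dotv; under eq_bigr do rewrite summxE mulr_suml.
  rewrite exchange_big; apply: eq_bigr => m _; rewrite -sumrB.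
  by apply: eq_bigr => i _; rewrite !mxE mulrBl ![_%:R * _]mulrC.
have cell0 : normal_cell S w 0.
  split; first by case: (vertex_cone0 u).
  by move=> m mS _ k kS; rewrite !mnm_eval0.
split; first by exists 0.
exists g; apply/seteqP; split=> [x [xA xtop]|x [Cx maxx]].
  have topx : mnm_top S x u by exact: xtop.
  split=> // z [_ ztop]; rewrite !gE [leRHS]big1_seq => [|m /andP[/asboolP mt mS]].
    rewrite big_seq_cond sumr_le0 // => m /andP[mS _].
    by rewrite subr_le0 ztop.
  by apply/eqP; rewrite subr_eq0; apply/eqP/(mnm_top_eq uS mS topx)/xtop.
have [xA topx] := Cx; split=> // m mS mt; apply/(mnm_top_eq uS mS topx).
have := maxx _ (vertex_cone0 u); rewrite !gE big1 => [|k _]; last first.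
  by rewrite !mnm_eval0 subrr.
rewrite big_mkcond (bigD1_seq m) ?msupp_uniq //= asboolT //.
set rest := (X in _ + X) => le; have rest_le0 : rest <= 0.
  rewrite /rest big_seq_cond sumr_le0 // => k /andP[kS _].
  by case: ifP => // _; rewrite subr_le0 topx.
by have := topx m mS; lra.
Qed.

End Faces.

(** * Sorted points, weight cones and highest weights *)

Lemma sorting_perm (R : realType) (n : nat) (w : 'rV[R]_n) :
  exists s : 'S_n, forall a b : 'I_n, (a <= b)%N -> w 0 (s b) <= w 0 (s a).
Proof.
pose ge_w : rel 'I_n := fun i j => w 0 j <= w 0 i.
pose t := sort ge_w (enum 'I_n).
have size_t : size t = n by rewrite size_sort size_enum_ord.
have inj_t : injective (fun i : 'I_n => nth i t i).
  move=> i j; rewrite (set_nth_default i j) ?size_t // => /eqP.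
  by rewrite nth_uniq ?size_t ?sort_uniq ?enum_uniq // => /eqP/val_inj.
exists (perm inj_t) => a b ab; rewrite !permE.
rewrite (set_nth_default a b) ?size_t //.
have ge_w_trans : transitive ge_w by move=> i j k ji ik; apply: le_trans ik ji.
have sorted_t : sorted ge_w t by apply: sort_sorted => i j; apply: le_total.
apply: (sorted_leq_nth ge_w_trans _ a sorted_t) ab; rewrite ?inE ?size_t //.
by move=> i; rewrite /ge_w.
Qed.

Section WeightCone.

Variables (R : realType) (K : fieldType) (n : nat) (V : vectType K).
Variables (e : n.-tuple V) (W : vectType K) (rho : 'End(V) -> 'End(W)).
Variable S : {mpoly int[n]}.
Hypothesis weightP : forall mu, is_weight e rho mu <->
  exists2 m, m \in msupp S & char_eq mu (mnm_char m).

(** Constant characters vanish on the apartment. *)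
Lemma char_eval_mnm (x : 'rV[R]_n) mu m : apartment x ->
  char_eq mu (mnm_char m) -> char_eval mu x = mnm_eval x m.
Proof.
move=> xA [k /(canRL (subrK _)) ->]; rewrite /char_eval.
under eq_bigr do rewrite !mxE rmorphD mulrDl.
rewrite big_split /= -mulr_sumr xA mulr0 add0r.
by apply: eq_bigr => i _; rewrite mulrC.
Qed.

Lemma weight_cone_vertex mu u : char_eq mu (mnm_char u) ->
  weight_cone e rho mu = vertex_cone S u :> set 'rV[R]_n.
Proof.
move=> muu; apply/seteqP; split=> x [xA H]; split=> //.
  move=> m mS; rewrite -(char_eval_mnm xA muu).
  have mm : char_eq (mnm_char m) (mnm_char m).
    by exists 0; rewrite subrr; apply/rowP => i; rewrite !mxE.
  by rewrite -(char_eval_mnm xA mm); apply/H/weightP; exists m.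
move=> nu /weightP[m mS num].
by rewrite (char_eval_mnm xA num) (char_eval_mnm xA muu); apply: H.
Qed.

End WeightCone.

(** Along [s] the exponents of [u] read [lam], so by dominance [u - m] has nonnegative prefix
    coordinates for every monomial [m] of [S]. This gives both the highest weight property and
    maximality at [w]. *)
Lemma sorted_highest_weight (R : realType) (K : fieldType) (n : nat)
    (V : vectType K) (e : n.+1.-tuple V) (W : vectType K)
    (rho : 'End(V) -> 'End(W)) (lam : 'I_n.+1 -> nat) (S : {mpoly int[n.+1]})
    (w : 'rV[R]_n.+1) (s : 'S_n.+1) :
  is_partition lam -> is_schur lam S ->
  (forall mu, is_weight e rho mu <->
     exists2 m, m \in msupp S & char_eq mu (mnm_char m)) ->
  (forall a b : 'I_n.+1, (a <= b)%N -> w 0 (s b) <= w 0 (s a)) ->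
  let u := [multinom lam (s^-1%g i) | i < n.+1] in
  is_highest_weight e rho (simple_pairs s) (mnm_char u) /\ mnm_top S w u.
Proof.
move=> plam hS weightP ws u.
have uS : u \in msupp S := schur_orbit_msupp plam hS s^-1%g.
pose x m := mnm_char u - mnm_char m.
have x0 m : m \in msupp S -> \sum_i x m 0 i = 0.
  move=> mS; rewrite /x; under eq_bigr do rewrite !mxE.
  rewrite sumrB -!(big_morph Posz PoszD (erefl _)) -!mdegE.
  by rewrite !(schur_mdeg hS) // subrr.
have xge0 m k : m \in msupp S -> 0 <= prefix_coord s k (x m).
  move=> mS; rewrite prefix_coordD prefix_coordN subr_ge0 /prefix_coord.
  under eq_bigr do rewrite mxE; under [leRHS]eq_bigr do rewrite mxE mnmE permK.
  rewrite -!(big_morph Posz PoszD (erefl _)) lez_nat.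
  exact: (schur_prefix_sum_le plam hS s k mS).
split; first split.
- apply/weightP; exists u => //; exists 0.
  by rewrite subrr; apply/rowP => i; rewrite !mxE.
- move=> mu /weightP[m mS [k mum]].
  have [c [l E]] := nonneg_comb_prefix (x0 m mS) (fun k => xge0 m k mS).
  (* The weight differs from [m] by the constant [k], and the expansion of [u - m] holds up to the
     constant [l]. *)
  exists c, (l - k); rewrite (_ : const_mx (l - k) = const_mx l - const_mx k).
    have -> : mu = const_mx k + mnm_char m by rewrite -mum subrK.
    rewrite -E /x opprD addrA [RHS]addrAC; congr (_ - _).
    by rewrite [RHS]addrAC.
  by apply/rowP => i; rewrite !mxE.
- move=> m mS; rewrite -subr_ge0.
  have := char_eval_prefix_ge0 ws (x0 m mS) (fun k => xge0 m k mS).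
  congr (0 <= _); rewrite /char_eval /mnm_eval -sumrB; apply: eq_bigr => i _.
  by rewrite !mxE rmorphB /= mulrBl ![w 0 i * _]mulrC.
Qed.

Theorem theorem2p4 (R : realType) (K : fieldType) (v : K -> R)
    (hchar : [pchar K] =i pred0) (hv : nontrivial_valuation v)
    (n : nat) (hn : (2 <= n)%N)
    (V : vectType K) (e : n.-tuple V) (he : basis_of fullv e)
    (lam : 'I_n -> nat) (hlam : is_partition lam)
    (S : {mpoly int[n]}) (hS : is_schur lam S)
    (d : nat) (W : vectType K) (f : d.-tuple W) (hf : basis_of fullv f)
    (rho : 'End(V) -> 'End(W))
    (hirr : geom_irreducible_algebraic e f rho)
    (htr : has_schur_character e f rho S)
    (hcoef : forall N : 'X_{1..n}, S@_N != 0 -> v (S@_N)%:~R = 0) :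
  fan e rho R = [set to_apartment @` C | C in poly_complex v S].
Proof.
case: n hn V e he lam hlam S hS W f hf rho hirr htr hcoef => [//|n] _ V e he lam
  hlam S hS W f hf rho [hrep [M hM _]] htr hcoef.
have hdeg : {in msupp S &, forall m m', mdeg m = mdeg m'}.
  by move=> m m' mS m'S; rewrite !(schur_mdeg hS).
have S0 : S != 0.
  rewrite -msupp_eq0; apply/eqP => E.
  by have := schur_orbit_msupp hlam hS 1%g; rewrite E.
have weightP := is_weight_msupp hchar (ltn0Sn n) he hf hrep hM htr hdeg.
rewrite poly_complex_image //; apply/seteqP; split=> [F|_ [w _ <-]].
  (* A highest weight is a monomial [u] of [S] up to a constant, so its cone is a vertex cone. *)
  move=> [D [mu [_ [/weightP[u uS muu] _] faceF]]].
  rewrite (weight_cone_vertex R weightP muu) in faceF.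
  by have [w ->] := vertex_cone_face uS faceF; exists w.
(* Conversely, the ordering that sorts [w] supplies a root basis whose highest weight is maximal at
   [w]. *)
have [s ws] := sorting_perm w.
have [highest top] := sorted_highest_weight hlam hS weightP ws.
set u := [multinom _ | i < _] in highest top.
exists (simple_pairs s), (mnm_char u); split=> //.
  exact: simple_pairs_root_basis.
rewrite (weight_cone_vertex R weightP (u := u)).
  by apply: normal_cell_face => //; apply: schur_orbit_msupp hlam hS _.
by exists 0; rewrite subrr; apply/rowP => i; rewrite !mxE.
Qed.
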